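(* Let $\mathcal{B}\subseteq\mathcal{D}$ be a unital inclusion of $C^\ast$-algebras, let $\mathcal{K}$ be a semi-inner-product $\mathcal{D}$-bimodule and $\mathcal{H}$ a semi-inner-product $\mathcal{B}$-bimodule. Put $$\mathcal{E}=\bigl(\mathcal{T}(\mathcal{H})\otimes_{\mathcal{B}}\mathcal{D}\bigr)\oplus\bigl(1_{\mathcal{B}}\otimes_{\mathcal{B}}\Omega\mathcal{D}\bigr)\oplus\bigl(\mathcal{T}(\mathcal{H})\otimes_{\mathcal{B}}\mathcal{K}\bigr).$$ Let $\xi\in\mathcal{H}$, $\eta\in\mathcal{K}$, let $t\in\mathcal{L}(\mathcal{H})$, $T\in\mathcal{L}(\mathcal{K})$ be selfadjoint, and let $\lambda_1\in\mathcal{B}$, $\lambda_2\in\mathcal{D}$ be selfadjoint. Let $$X=a_\xi+a_\xi^\ast+p(t)+\lambda_1I_1+A_\eta+A_\eta^\ast+P(T)+\lambda_2I_2\in\mathcal{L}(\mathcal{E}),$$ with the operators defined in the context. Then the free cumulants $\kappa_{n,X}$ of $X$ with respect to $\varphi=\langle\,\cdot\,(1\otimes1),1\otimes1\rangle$ and the c-free cumulants ${}^c\kappa_{n,X}$ of $X$ with respect to $(\theta,\varphi)$, where $\theta=\langle\,\cdot\,(1\otimes\Omega),1\otimes\Omega\rangle$, are given, for all $b_1,\dots,b_n\in\mathcal{B}$, by $$\kappa_{1,X}(b_1)=\lambda_1b_1,\qquad \kappa_{n,X}(b_1,\dots,b_n)=\langle a_\xi b_1p(t)b_2\cdots p(t)b_{n-1}a_\xi^\ast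 b_n(1\otimes1),1\otimes1\rangle\quad(n\ge2),$$ $${}^c\kappa_{1,X}(b_1)=\lambda_2b_1,\qquad {}^c\kappa_{n,X}(b_1,\dots,b_n)=\langle A_\eta b_1P(T)b_2\cdots P(T)b_{n-1}A_\eta^\ast b_n(1\otimes\Omega),1\otimes\Omega\rangle\quad(n\ge2).$$
   Context: A semi-inner-product $A$-module ($A$ a $C^\ast$-algebra) is a right $A$-module $E$ with a map $\langle\cdot,\cdot\rangle:E\times E\to A$, linear in the first variable, with $\langle xa,y\rangle=\langle x,y\rangle a$, $\langle x,y\rangle=\langle y,x\rangle^\ast$, $\langle x,x\rangle\ge0$. A semi-inner-product $A$-bimodule is in addition a left $A$-module on which $A$ acts by right $A$-linear maps with $\langle ax,y\rangle=\langle x,a^\ast y\rangle$. $\mathcal{L}(E)$ is the set of adjointable (right $A$-linear) maps $E\to E$; $S$ is selfadjoint if $\langle Sx,y\rangle=\langle x,Sy\rangle$. $\mathcal{T}(\mathcal{H})=\mathcal{B}\oplus\mathcal{H}\oplus(\mathcal{H}\otimes_{\mathcal{B}}\mathcal{H})\oplus\cdots$ is the full Fock $\mathcal{B}$-module with $\langle x_1\otimes x_2,y_1\otimes y_2\rangle=\langle\langle x_1,y_1\rangle x_2,y_2\rangle$ (iterated), orthogonal direct sum, and $\langle\alpha,\alpha'\rangle=\alpha'^\ast\alpha$ on $\mathcal{B}$. $\Omega$ is a symbol commuting with $\mathcal{D}$ with $\langle\Omega d,\Omega d'\rangle=d'^\ast d$. $\mathcal{E}$ is the orthogonal direct sum,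 a right $\mathcal{D}$-module with $\mathcal{D}$-valued semi-inner product given by $\langle x\otimes d,y\otimes d'\rangle=d'^\ast\langle x,y\rangle d$ on $\mathcal{T}(\mathcal{H})\otimes_{\mathcal{B}}\mathcal{D}$, $\langle x\otimes\zeta,y\otimes\zeta'\rangle=\langle\langle x,y\rangle\zeta,\zeta'\rangle$ on $\mathcal{T}(\mathcal{H})\otimes_{\mathcal{B}}\mathcal{K}$. $\mathcal{B}$ acts on $\mathcal{E}$ on the left: by its left action on $\mathcal{T}(\mathcal{H})$ on the first and third summands and by $b(1\otimes\Omega d)=1\otimes\Omega bd$ on the second; $\mathcal{D}$ acts on the second summand by $d'(1\otimes\Omega d)=1\otimes\Omega d'd$. Operators on $\mathcal{E}$ ($f_i\in\mathcal{H}$, $\alpha\in\mathcal{B}$, $\zeta\in\mathcal{K}$, $d\in\mathcal{D}$, and $w$ denotes an element of $\mathcal{D}$ or of $\mathcal{K}$): $a_\xi,a_\xi^\ast,p(t)$ vanish on $1\otimes\Omega\mathcal{D}$, and $a_\xi((f_1\otimes\cdots\otimes f_n)\otimes w)=(\langle f_1,\xi\rangle f_2\otimes\cdots\otimes f_n)\otimes w$, $a_\xi(\alpha\otimes w)=0$; $a_\xi^\ast((f_1\otimes\cdots\otimes f_n)\otimes w)=(\xi\otimes f_1\otimes\cdots\otimes f_n)\otimes w$, $a_\xi^\ast(\alpha\otimes w)=\xi\alpha\otimes w$; $p(t)((f_1\otimes\cdots\otimes f_n)\otimes w)=(t(f_1)\otimes f_2\otimes\cdots\otimes f_n)\otimes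 w$, $p(t)(\alpha\otimes w)=0$. $A_\eta(1\otimes\zeta)=1\otimes\Omega\langle\zeta,\eta\rangle$ for $\zeta\in\mathcal{K}$, and $A_\eta=0$ on the other direct summands of $\mathcal{E}$ (the complement of $1\otimes\mathcal{K}$); $A_\eta^\ast(1\otimes\Omega d)=1\otimes\eta d$, and $A_\eta^\ast=0$ on the complement of $1\otimes\Omega\mathcal{D}$; $P(T)(1\otimes\zeta)=1\otimes T\zeta$, and $P(T)=0$ on the complement of $1\otimes\mathcal{K}$. $I_1$ is the identity on $(\mathcal{T}(\mathcal{H})\otimes_{\mathcal{B}}\mathcal{D})\oplus(\mathcal{T}(\mathcal{H})\otimes_{\mathcal{B}}\mathcal{K})$ and $0$ on $1\otimes\Omega\mathcal{D}$; $I_2$ is the identity on $1\otimes\Omega\mathcal{D}$ and $0$ elsewhere. Cumulants: $\kappa_{n,X}:\mathcal{B}^n\to\mathcal{B}$ and ${}^c\kappa_{n,X}:\mathcal{B}^n\to\mathcal{D}$ are the multilinear maps determined recursively by $$\varphi(Xb_1\cdots Xb_n)=\sum_{p=1}^n\ \sum_{0=j_0<j_1<\dots<j_p=n}\kappa_{p,X}(Y_1,\dots,Y_p),\quad Y_s=b_{j_{s-1}+1}\varphi(Xb_{j_{s-1}+2}\cdots Xb_{j_s}),$$ $$\theta(Xb_1\cdots Xb_n)=\sum_{p=1}^n\ \sum_{0\le l_1<\dots<l_p=n-1}\theta(Xb_1\cdots Xb_{l_1})\,{}^c\kappa_{p,X}(Z_1,\dots,Z_{p-1},b_n),\quad Z_s=b_{l_s+1}\varphi(Xb_{l_s+2}\cdots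 Xb_{l_{s+1}}),$$ with $\varphi,\theta$ of the empty word equal to $1$ (on the algebra generated by $\mathcal{B}$ and $X$, $\varphi$ takes values in $\mathcal{B}$). *)

(* Defs.v *)
From HB Require Import structures.
From mathcomp Require Import all_boot all_order all_algebra.
From mathcomp Require Import generic_quotient.
From mathcomp Require Import mathcomp_extra boolp classical_sets cardinality.
From mathcomp Require Import fsbigop reals.
From mathcomp Require Import complex.

Set Implicit Arguments.
Unset Strict Implicit.
Unset Printing Implicit Defensive.
#[local] Obligation Tactic := idtac.

Import Order.TTheory GRing.Theory Num.Theory.
Local Open Scope ring_scope.
Local Open Scope quotient_scope.
Local Open Scope complex_scope.

(* MathComp has no ring structure compatible with the normed module hierarchy
   (numDomainType excepted), hence the explicit norm and completeness. *)
HB.mixin Record isCStarAlgebra (R : realType) A of GRing.Algebra R[i] A := {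
  star : A -> A ;
  cnorm : A -> R ;
  starD : forall a b : A, star (a + b) = star a + star b ;
  starZ : forall (c : R[i]) (a : A), star (c *: a) = (c^*)%R *: star a ;
  starM : forall a b : A, star (a * b) = star b * star a ;
  starK : involutive star ;
  cnorm_eq0 : forall a : A, cnorm a = 0 -> a = 0 ;
  cnormD : forall a b : A, cnorm (a + b) <= cnorm a + cnorm b ;
  cnormZ : forall (c : R[i]) (a : A),
    (cnorm (c *: a))%:C = `|c| * (cnorm a)%:C ;
  cnormM : forall a b : A, cnorm (a * b) <= cnorm a * cnorm b ;
  cnorm_star : forall a : A, cnorm (star a * a) = cnorm a ^+ 2 ;
  cnorm_complete : forall u : nat -> A,
    (forall e : R, 0 < e -> exists N, forall m n,
       (N <= m)%N -> (N <= n)%N -> cnorm (u m - u n) < e) ->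
    exists l : A, forall e : R, 0 < e -> exists N, forall n,
      (N <= n)%N -> cnorm (u n - l) < e }.

#[short(type="cstarAlgType")]
HB.structure Definition CStarAlgebra (R : realType) :=
  { A of GRing.Algebra R[i] A & isCStarAlgebra R A }.

Section CStarTheory.
Context {R : realType} {A : cstarAlgType R}.
Implicit Types a b : A.

Definition invertible a := exists b, a * b = 1 /\ b * a = 1.

(* selfadjoint with nonnegative spectrum; 0 <= c in R[i] means that c is real
   and nonnegative *)
Definition cpositive a :=
  star a = a /\ forall c : R[i], ~ invertible (a - c%:A) -> 0 <= c.

Lemma star0 : star (0 : A) = 0.
Proof. by apply: (addrI (star 0)); rewrite -starD !addr0. Qed.

Lemma star1 : star (1 : A) = 1.
Proof. by rewrite -[LHS]mulr1 -{2}(starK 1) -starM mulr1 starK. Qed.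

Lemma star_sum I (s : seq I) (F : I -> A) :
  star (\sum_(i <- s) F i) = \sum_(i <- s) star (F i).
Proof. exact: (big_morph _ starD star0). Qed.

End CStarTheory.

Record unital_inclusion (R : realType) (B D : cstarAlgType R) := UnitalInclusion {
  incl :> {lrmorphism B -> D} ;
  incl_star : forall b, incl (star b) = star (incl b) ;
  incl_inj : injective incl }.

(* Right A-modules with a hermitian A-valued form and a left action of B by
   adjointable maps.  As 1 acts as the identity, the complex structure is
   z x = x (z 1); corr_scal says that it is also z x = (z 1) x.  Positivity of
   the form is a separate condition, see sipBimod. *)
Record corr (R : realType) (B A : cstarAlgType R) := Corr {
  corr_sort :> zmodType ;
  lact : B -> corr_sort -> corr_sort ;
  ract : corr_sort -> A -> corr_sort ;
  form : corr_sort -> corr_sort -> A ;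
  lactDl : forall b b' x, lact (b + b') x = lact b x + lact b' x ;
  lactDr : forall b x y, lact b (x + y) = lact b x + lact b y ;
  lactM : forall b b' x, lact (b * b') x = lact b (lact b' x) ;
  lact1 : forall x, lact 1 x = x ;
  ractDl : forall x y a, ract (x + y) a = ract x a + ract y a ;
  ractDr : forall x a a', ract x (a + a') = ract x a + ract x a' ;
  ractM : forall x a a', ract x (a * a') = ract (ract x a) a' ;
  ract1 : forall x, ract x 1 = x ;
  lract : forall b x a, lact b (ract x a) = ract (lact b x) a ;
  corr_scal : forall (z : R[i]) x, lact (z%:A) x = ract x (z%:A) ;
  formDl : forall x y z, form (x + y) z = form x z + form y z ;
  form_ract : forall x y a, form (ract x a) y = form x y * a ;
  form_star : forall x y, form x y = star (form y x) ;
  form_lact : forall b x y, form (lact b x) y = form x (lact (star b) y) }.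

Reserved Notation "b ▷ x" (at level 39, left associativity).
Reserved Notation "x ◁ a" (at level 39, left associativity).
Reserved Notation "⟨ x , y ⟩" (at level 0, format "⟨ x ,  y ⟩").
Notation "b ▷ x" := (lact b x) : ring_scope.
Notation "x ◁ a" := (ract x a) : ring_scope.
Notation "⟨ x , y ⟩" := (form x y) : ring_scope.

Record sipBimod (R : realType) (A : cstarAlgType R) := SipBimod {
  sip_corr :> corr A A ;
  sip_ge0 : forall x : sip_corr, cpositive ⟨x, x⟩ }.

Section CorrTheory.
Context {R : realType} {B A : cstarAlgType R} {M : corr B A}.
Implicit Types (x y : M) (a : A) (b : B).

Lemma lact0 b : b ▷ (0 : M) = 0.
Proof. by apply: (addrI (b ▷ 0)); rewrite -lactDr !addr0. Qed.
Lemma lact0l x : 0 ▷ x = 0.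
Proof. by apply: (addrI (0 ▷ x)); rewrite -lactDl !addr0. Qed.
Lemma ract0 a : (0 : M) ◁ a = 0.
Proof. by apply: (addrI (0 ◁ a)); rewrite -ractDl !addr0. Qed.
Lemma ract0r x : x ◁ 0 = 0.
Proof. by apply: (addrI (x ◁ 0)); rewrite -ractDr !addr0. Qed.
Lemma form0l y : ⟨0, y⟩ = 0 :> A.
Proof. by apply: (addrI (form (0 : M) y)); rewrite -formDl !addr0. Qed.
Lemma form0r x : ⟨x, 0⟩ = 0 :> A.
Proof. by rewrite form_star form0l star0. Qed.
Lemma formDr x y z : ⟨x, y + z⟩ = ⟨x, y⟩ + ⟨x, z⟩.
Proof. by rewrite form_star formDl starD -!form_star. Qed.
Lemma form_ractr x y a : ⟨x, y ◁ a⟩ = star a * ⟨x, y⟩.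
Proof. by rewrite form_star form_ract starM -form_star. Qed.

End CorrTheory.

Record rlin (R : realType) (B A : cstarAlgType R) (M N : corr B A) := RLin {
  rfun :> M -> N ;
  rlinD : forall x y, rfun (x + y) = rfun x + rfun y ;
  rlinR : forall x a, rfun (x ◁ a) = rfun x ◁ a }.

Lemma rlin0 (R : realType) (B A : cstarAlgType R) (M N : corr B A)
  (f : rlin M N) : f 0 = 0.
Proof. by apply: (addrI (f 0)); rewrite -rlinD !addr0. Qed.

(* The adjointable maps: adjointable M is the set L(M). *)
Record adjointable (R : realType) (B A : cstarAlgType R) (M : corr B A) :=
  Adjointable {
    adj_rlin :> rlin M M ;
    adjP : exists S : M -> M, forall x y, ⟨adj_rlin x, y⟩ = ⟨x, S y⟩ }.

Definition selfadjoint (R : realType) (B A : cstarAlgType R) (M : corr B A)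
  (S : M -> M) := forall x y, ⟨S x, y⟩ = ⟨x, S y⟩.

Program Definition self_corr (R : realType) (A : cstarAlgType R) : corr A A :=
  @Corr R A A A (fun b x => b * x) (fun x a => x * a) (fun x y => star y * x)
    _ _ _ _ _ _ _ _ _ _ _ _ _ _.
Next Obligation. by move=> * /=; rewrite mulrDl. Qed.
Next Obligation. by move=> * /=; rewrite mulrDr. Qed.
Next Obligation. by move=> * /=; rewrite mulrA. Qed.
Next Obligation. by move=> * /=; rewrite mul1r. Qed.
Next Obligation. by move=> * /=; rewrite mulrDl. Qed.
Next Obligation. by move=> * /=; rewrite mulrDr. Qed.
Next Obligation. by move=> * /=; rewrite mulrA. Qed.
Next Obligation. by move=> * /=; rewrite mulr1. Qed.
Next Obligation. by move=> * /=; rewrite mulrA. Qed.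
Next Obligation. by move=> * /=; rewrite -scalerAl -scalerAr mul1r mulr1. Qed.
Next Obligation. by move=> * /=; rewrite mulrDr. Qed.
Next Obligation. by move=> * /=; rewrite mulrA. Qed.
Next Obligation. by move=> * /=; rewrite starM starK. Qed.
Next Obligation. by move=> * /=; rewrite starM starK mulrA. Qed.

Program Definition restrict (R : realType) (B D A : cstarAlgType R)
    (i : unital_inclusion B D) (M : corr D A) : corr B A :=
  @Corr R B A M (fun b x => i b ▷ x) (@ract _ _ _ M) (@form _ _ _ M)
    _ _ _ _ _ _ _ _ _ _ _ _ _ _.
Next Obligation. by move=> * /=; rewrite rmorphD lactDl. Qed.
Next Obligation. by move=> * /=; rewrite lactDr. Qed.
Next Obligation. by move=> * /=; rewrite rmorphM lactM. Qed.
Next Obligation. by move=> * /=; rewrite rmorph1 lact1. Qed.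
Next Obligation. by move=> * /=; rewrite ractDl. Qed.
Next Obligation. by move=> * /=; rewrite ractDr. Qed.
Next Obligation. by move=> * /=; rewrite ractM. Qed.
Next Obligation. by move=> * /=; rewrite ract1. Qed.
Next Obligation. by move=> * /=; rewrite lract. Qed.
Next Obligation. by move=> * /=; rewrite linearZ rmorph1 corr_scal. Qed.
Next Obligation. by move=> * /=; rewrite formDl. Qed.
Next Obligation. by move=> * /=; rewrite form_ract. Qed.
Next Obligation. by move=> * /=; rewrite form_star. Qed.
Next Obligation. by move=> * /=; rewrite form_lact incl_star. Qed.

(* M ⊗_A N is the group of formal sums of pairs (x, y) modulo the intersection
   of the kernels of all balanced biadditive maps, that is modulo the
   congruence generated by the relations of the tensor product. *)
Section Tensor.
Context {R : realType} {B A C : cstarAlgType R} {M : corr B A} {N : corr A C}.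

Record balanced (G : zmodType) := Balanced {
  bfun :> M -> N -> G ;
  bfunDl : forall x x' y, bfun (x + x') y = bfun x y + bfun x' y ;
  bfunDr : forall x y y', bfun x (y + y') = bfun x y + bfun x y' ;
  bfunM : forall x a y, bfun (x ◁ a) y = bfun x (a ▷ y) }.

Definition bsum (G : zmodType) (f : balanced G) (s : seq (M * N)) : G :=
  \sum_(p <- s) f p.1 p.2.

Definition tens_rel : rel (seq (M * N)) := fun s s' =>
  `[< forall (G : zmodType) (f : balanced G), bsum f s = bsum f s' >].

Lemma tens_rel_equiv : equiv_class_of tens_rel.
Proof.
split=> [s|s s'|s s' s'']; first exact/asboolP.
  by apply/asboolP/asboolP => h G f; rewrite h.
by move=> /asboolP h /asboolP h'; apply/asboolP => G f; rewrite h h'.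
Qed.
Canonical tens_equiv := EquivRelPack tens_rel_equiv.

Definition tens_type := {eq_quot tens_equiv}.
HB.instance Definition _ := Choice.on tens_type.

Definition tpi (s : seq (M * N)) : tens_type := \pi_tens_type s.

Lemma tpiP s s' :
  tpi s = tpi s' <-> forall (G : zmodType) (f : balanced G), bsum f s = bsum f s'.
Proof. by split=> [/eqmodP /asboolP //|h]; apply/eqmodP/asboolP. Qed.

Lemma tpiK q : tpi (repr q) = q.
Proof. exact: reprK. Qed.

Lemma bsum_repr (G : zmodType) (f : balanced G) s :
  bsum f (repr (tpi s)) = bsum f s.
Proof. by move: G f; apply/tpiP; rewrite tpiK. Qed.

Lemma bsum_cat (G : zmodType) (f : balanced G) s s' :
  bsum f (s ++ s') = bsum f s + bsum f s'.
Proof. by rewrite /bsum big_cat. Qed.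

Lemma bfun0 (G : zmodType) (f : balanced G) y : f 0 y = 0.
Proof. by apply: (addrI (f 0 y)); rewrite -bfunDl !addr0. Qed.

Lemma bfun0r (G : zmodType) (f : balanced G) x : f x 0 = 0.
Proof. by apply: (addrI (f x 0)); rewrite -bfunDr !addr0. Qed.

Definition neg_word (s : seq (M * N)) := [seq (- p.1, p.2) | p <- s].

Lemma bsum_neg (G : zmodType) (f : balanced G) s :
  bsum f (neg_word s) = - bsum f s.
Proof.
rewrite /bsum big_map -sumrN; apply: eq_bigr => p _ /=.
by apply: (addrI (f p.1 p.2)); rewrite -bfunDl !subrr bfun0.
Qed.

Definition tadd (q q' : tens_type) := tpi (repr q ++ repr q').
Definition topp (q : tens_type) := tpi (neg_word (repr q)).
Definition tzero := tpi [::].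

Fact taddA : associative tadd.
Proof. by move=> p q r; apply/tpiP => G f; rewrite !(bsum_cat, bsum_repr) addrA. Qed.
Fact taddC : commutative tadd.
Proof. by move=> p q; apply/tpiP => G f; rewrite !bsum_cat addrC. Qed.
Fact tadd0 : left_id tzero tadd.
Proof.
move=> p; rewrite -[RHS]tpiK; apply/tpiP => G f.
by rewrite bsum_cat bsum_repr [bsum f [::]]big_nil add0r.
Qed.
Fact taddN : left_inverse tzero topp tadd.
Proof.
move=> p; apply/tpiP => G f.
by rewrite bsum_cat bsum_repr bsum_neg addNr /bsum big_nil.
Qed.
HB.instance Definition _ :=
  GRing.isZmodule.Build tens_type taddA taddC tadd0 taddN.

Lemma tpiD s s' : tpi s + tpi s' = tpi (s ++ s').
Proof. by apply/tpiP => G f; rewrite !bsum_cat !bsum_repr. Qed.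

Definition tpure (x : M) (y : N) : tens_type := tpi [:: (x, y)].

Definition tlift (G : zmodType) (f : balanced G) (q : tens_type) : G :=
  bsum f (repr q).

Lemma tliftE (G : zmodType) (f : balanced G) x y : tlift f (tpure x y) = f x y.
Proof. by rewrite /tlift bsum_repr /bsum big_seq1. Qed.

Lemma tliftD (G : zmodType) (f : balanced G) p q :
  tlift f (p + q) = tlift f p + tlift f q.
Proof. by rewrite /tlift /GRing.add /= bsum_repr bsum_cat. Qed.

Lemma tlift0 (G : zmodType) (f : balanced G) : tlift f 0 = 0.
Proof. by apply: (addrI (tlift f 0)); rewrite -tliftD !addr0. Qed.

Program Definition pureb : balanced tens_type :=
  @Balanced tens_type tpure _ _ _.
Next Obligation.
by move=> x x' y; rewrite /tpure tpiD; apply/tpiP => G f; rewrite bsum_cat /bsum !big_seq1 bfunDl.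
Qed.
Next Obligation.
by move=> x x' y; rewrite /tpure tpiD; apply/tpiP => G f; rewrite bsum_cat /bsum !big_seq1 bfunDr.
Qed.
Next Obligation.
by move=> x a y; apply/tpiP => G f; rewrite /bsum !big_seq1 bfunM.
Qed.

Lemma tpureDl x x' y : tpure (x + x') y = tpure x y + tpure x' y.
Proof. exact: (bfunDl pureb). Qed.
Lemma tpureDr x y y' : tpure x (y + y') = tpure x y + tpure x y'.
Proof. exact: (bfunDr pureb). Qed.
Lemma tpureM x a y : tpure (x ◁ a) y = tpure x (a ▷ y).
Proof. exact: (bfunM pureb). Qed.
Lemma tpure0l y : tpure 0 y = 0.
Proof. exact: (bfun0 pureb). Qed.
Lemma tpure0r x : tpure x 0 = 0.
Proof. exact: (bfun0r pureb). Qed.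

Lemma tens_ind (P : tens_type -> Prop) :
  P 0 -> (forall p q, P p -> P q -> P (p + q)) ->
  (forall x y, P (tpure x y)) -> forall q, P q.
Proof.
move=> P0 PD Pp q; rewrite -(tpiK q); elim: (repr q) => [//|[x y] s IHs].
suff -> : tpi ((x, y) :: s) = tpure x y + tpi s by apply: PD.
by rewrite tpiD.
Qed.

Program Definition lactb (b : B) : balanced tens_type :=
  @Balanced _ (fun x y => tpure (b ▷ x) y) _ _ _.
Next Obligation. by move=> * /=; rewrite lactDr tpureDl. Qed.
Next Obligation. by move=> * /=; rewrite tpureDr. Qed.
Next Obligation. by move=> * /=; rewrite lract tpureM. Qed.

Program Definition ractb (c : C) : balanced tens_type :=
  @Balanced _ (fun x y => tpure x (y ◁ c)) _ _ _.
Next Obligation. by move=> * /=; rewrite tpureDl. Qed.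
Next Obligation. by move=> * /=; rewrite ractDl tpureDr. Qed.
Next Obligation. by move=> * /=; rewrite -lract tpureM. Qed.

Program Definition formb (x1 : M) (x2 : N) : balanced C :=
  @Balanced _ (fun y1 y2 => ⟨⟨y1, x1⟩ ▷ y2, x2⟩) _ _ _.
Next Obligation. by move=> * /=; rewrite formDl lactDl formDl. Qed.
Next Obligation. by move=> * /=; rewrite lactDr formDl. Qed.
Next Obligation. by move=> * /=; rewrite form_ract lactM. Qed.

Program Definition formb2 (p : tens_type) : balanced C :=
  @Balanced _ (fun x1 x2 => tlift (formb x1 x2) p) _ _ _.
Next Obligation.
move=> p x x' y; elim/tens_ind: p => [|p q hp hq|y1 y2].
- by rewrite !tlift0 addr0.
- by rewrite !tliftD hp hq addrACA.
- by rewrite !tliftE /= formDr lactDl formDl.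
Qed.
Next Obligation.
move=> p x y y'; elim/tens_ind: p => [|p q hp hq|y1 y2].
- by rewrite !tlift0 addr0.
- by rewrite !tliftD hp hq addrACA.
- by rewrite !tliftE /= formDr.
Qed.
Next Obligation.
move=> p x a y; elim/tens_ind: p => [|p q hp hq|y1 y2].
- by rewrite !tlift0.
- by rewrite !tliftD hp hq.
- by rewrite !tliftE /= form_ractr lactM form_lact starK.
Qed.

Definition tform (p q : tens_type) : C := tlift (formb2 p) q.

Lemma tformE x1 x2 y1 y2 :
  tform (tpure x1 x2) (tpure y1 y2) = ⟨⟨x1, y1⟩ ▷ x2, y2⟩.
Proof. by rewrite /tform !tliftE /= tliftE. Qed.

Lemma tformDr p q q' : tform p (q + q') = tform p q + tform p q'.
Proof. exact: tliftD. Qed.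

Lemma tformDl p p' q : tform (p + p') q = tform p q + tform p' q.
Proof.
elim/tens_ind: q => [|q q' h h'|x y].
- by rewrite /tform !tlift0 addr0.
- by rewrite !tformDr h h' addrACA.
- by rewrite /tform !tliftE /= tliftD.
Qed.

Lemma tform0l q : tform 0 q = 0.
Proof. by apply: (addrI (tform 0 q)); rewrite -tformDl !addr0. Qed.
Lemma tform0r p : tform p 0 = 0.
Proof. exact: tlift0. Qed.

Program Definition tens : corr B C :=
  @Corr R B C tens_type (fun b => tlift (lactb b)) (fun q c => tlift (ractb c) q)
    tform _ _ _ _ _ _ _ _ _ _ _ _ _ _.
Next Obligation.
move=> b b' q; elim/tens_ind: q => [|p q hp hq|x y].
- by rewrite !tlift0 addr0.
- by rewrite !tliftD hp hq addrACA.
- by rewrite !tliftE /= lactDl tpureDl.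
Qed.
Next Obligation. by move=> * /=; rewrite tliftD. Qed.
Next Obligation.
move=> b b' q; elim/tens_ind: q => [|p q hp hq|x y].
- by rewrite !tlift0.
- by rewrite !tliftD hp hq.
- by do !rewrite tliftE /=; rewrite lactM.
Qed.
Next Obligation.
move=> q; elim/tens_ind: q => [|p q hp hq|x y].
- by rewrite !tlift0.
- by rewrite !tliftD hp hq.
- by rewrite !tliftE /= lact1.
Qed.
Next Obligation. by move=> * /=; rewrite tliftD. Qed.
Next Obligation.
move=> q b b'; elim/tens_ind: q => [|p q hp hq|x y].
- by rewrite !tlift0 addr0.
- by rewrite !tliftD hp hq addrACA.
- by rewrite !tliftE /= ractDr tpureDr.
Qed.
Next Obligation.
move=> q b b'; elim/tens_ind: q => [|p q hp hq|x y].
- by rewrite !tlift0.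
- by rewrite !tliftD hp hq.
- by do !rewrite tliftE /=; rewrite ractM.
Qed.
Next Obligation.
move=> q; elim/tens_ind: q => [|p q hp hq|x y].
- by rewrite !tlift0.
- by rewrite !tliftD hp hq.
- by rewrite !tliftE /= ract1.
Qed.
Next Obligation.
move=> b q c; elim/tens_ind: q => [|p q hp hq|x y].
- by rewrite !tlift0.
- by rewrite !tliftD hp hq.
- by do !rewrite tliftE /=.
Qed.
Next Obligation.
move=> z q; elim/tens_ind: q => [|p q hp hq|x y].
- by rewrite !tlift0.
- by rewrite !tliftD hp hq.
- by rewrite !tliftE /= corr_scal tpureM corr_scal.
Qed.
Next Obligation. by move=> * /=; rewrite tformDl. Qed.
Next Obligation.
move=> p q c; elim/tens_ind: p => [|p p' hp hp'|x y].
- by rewrite tlift0 !tform0l mul0r.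
- by rewrite tliftD !tformDl hp hp' mulrDl.
rewrite tliftE /=; elim/tens_ind: q => [|q q' hq hq'|x' y'].
- by rewrite !tform0r mul0r.
- by rewrite !tformDr hq hq' mulrDl.
- by rewrite !tformE lract form_ract.
Qed.
Next Obligation.
move=> p q; elim/tens_ind: p => [|p p' hp hp'|x y].
- by rewrite tform0l tform0r star0.
- by rewrite tformDr tformDl starD hp hp'.
elim/tens_ind: q => [|q q' hq hq'|x' y'].
- by rewrite tform0l tform0r star0.
- by rewrite tformDr tformDl starD hq hq'.
- by rewrite !tformE -[RHS]form_star form_lact -form_star.
Qed.
Next Obligation.
move=> b p q; elim/tens_ind: p => [|p p' hp hp'|x y].
- by rewrite tlift0 !tform0l.
- by rewrite tliftD !tformDl hp hp'.
rewrite tliftE /=; elim/tens_ind: q => [|q q' hq hq'|x' y'].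
- by rewrite tlift0 !tform0r.
- by rewrite tliftD !tformDr hq hq'.
- by rewrite !tliftE /= !tformE (form_lact b).
Qed.

End Tensor.

Arguments tens {R B A C} M N.
Arguments tpure {R B A C M N} x y.
Notation "x ⊗ y" := (tpure x y) (at level 39, left associativity) : ring_scope.

Section TensorMap.
Context {R : realType} {B A C : cstarAlgType R} {M M' : corr B A} {N : corr A C}.

Program Definition tmapb (g : rlin M M') : balanced (M := M) (N := N) (tens M' N) :=
  @Balanced _ _ _ _ M N (tens M' N) (fun x y => g x ⊗ y) _ _ _.
Next Obligation. by move=> * /=; rewrite rlinD tpureDl. Qed.
Next Obligation. by move=> * /=; rewrite tpureDr. Qed.
Next Obligation. by move=> * /=; rewrite rlinR tpureM. Qed.

Program Definition tmap (g : rlin M M') : rlin (tens M N) (tens M' N) :=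
  @RLin _ _ _ _ _ (tlift (tmapb g)) _ _.
Next Obligation. by move=> * /=; rewrite tliftD. Qed.
Next Obligation.
move=> g q c; elim/(@tens_ind _ _ _ _ M N): q => [|p q hp hq|x y].
- by rewrite ract0 tlift0 ract0.
- by rewrite ractDl !tliftD ractDl hp hq.
- by do !rewrite tliftE /=.
Qed.

Lemma tmapE (g : rlin M M') x (y : N) : tmap g (x ⊗ y) = g x ⊗ y.
Proof. exact: tliftE. Qed.

End TensorMap.

Section DirectSum.
Context {R : realType} {B A : cstarAlgType R} (V : nat -> corr B A).

Record dsum_type := DSum {
  dval :> forall n, V n ;
  dvalP : exists N, forall n, (N <= n)%N -> dval n = 0 }.

Lemma dsumP (x y : dsum_type) : (forall n, x n = y n) -> x = y.
Proof.
case: x y => [x xP] [y yP] /= xy; have {xy} xy : x = y by apply: functional_extensionality_dep.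
by subst y; congr DSum; exact: Prop_irrelevance.
Qed.

HB.instance Definition _ := gen_eqMixin dsum_type.
HB.instance Definition _ := gen_choiceMixin dsum_type.

Program Definition dzero : dsum_type := @DSum (fun n => 0) _.
Next Obligation. by exists 0%N. Qed.
Program Definition dopp (x : dsum_type) : dsum_type := @DSum (fun n => - x n) _.
Next Obligation.
by move=> x; have [N xN] := dvalP x; exists N => n /xN ->; rewrite oppr0.
Qed.
Program Definition dadd (x y : dsum_type) : dsum_type :=
  @DSum (fun n => x n + y n) _.
Next Obligation.
move=> x y; have [N xN] := dvalP x; have [N' yN] := dvalP y.
exists (maxn N N') => n; rewrite geq_max => /andP[/xN -> /yN ->].
by rewrite addr0.
Qed.
Fact daddA : associative dadd.
Proof. by move=> x y z; apply: dsumP => n /=; rewrite addrA. Qed.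
Fact daddC : commutative dadd.
Proof. by move=> x y; apply: dsumP => n /=; rewrite addrC. Qed.
Fact dadd0 : left_id dzero dadd.
Proof. by move=> x; apply: dsumP => n /=; rewrite add0r. Qed.
Fact daddN : left_inverse dzero dopp dadd.
Proof. by move=> x; apply: dsumP => n /=; rewrite addNr. Qed.
HB.instance Definition _ :=
  GRing.isZmodule.Build dsum_type daddA daddC dadd0 daddN.

Definition dform (x y : dsum_type) : A := \sum_(n \in [set: nat]) ⟨x n, y n⟩.

Lemma dformE N (x y : dsum_type) : (forall n, (N <= n)%N -> x n = 0) ->
  dform x y = \sum_(n < N) ⟨x n, y n⟩.
Proof.
move=> xN; rewrite /dform (fsbig_ord _ N (fun n => form (x n) (y n))).
apply/esym/fsbig_widen => // n [_ /=] /negP.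
by rewrite -leqNgt => /xN ->; rewrite form0l.
Qed.

Program Definition dlact (b : B) (x : dsum_type) : dsum_type :=
  @DSum (fun n => b ▷ x n) _.
Next Obligation.
by move=> b x; have [N xN] := dvalP x; exists N => n /xN ->; rewrite lact0.
Qed.
Program Definition dract (x : dsum_type) (a : A) : dsum_type :=
  @DSum (fun n => x n ◁ a) _.
Next Obligation.
by move=> x a; have [N xN] := dvalP x; exists N => n /xN ->; rewrite ract0.
Qed.

Lemma dbound2 (x y : dsum_type) :
  exists N, forall n, (N <= n)%N -> x n = 0 /\ y n = 0.
Proof.
have [N xN] := dvalP x; have [N' yN] := dvalP y.
by exists (maxn N N') => n; rewrite geq_max => /andP[/xN ? /yN ?].
Qed.

Program Definition dsum : corr B A :=
  @Corr R B A dsum_type dlact dract dform _ _ _ _ _ _ _ _ _ _ _ _ _ _.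
Next Obligation. by move=> *; apply: dsumP => n /=; rewrite lactDl. Qed.
Next Obligation. by move=> *; apply: dsumP => n /=; rewrite lactDr. Qed.
Next Obligation. by move=> *; apply: dsumP => n /=; rewrite lactM. Qed.
Next Obligation. by move=> *; apply: dsumP => n /=; rewrite lact1. Qed.
Next Obligation. by move=> *; apply: dsumP => n /=; rewrite ractDl. Qed.
Next Obligation. by move=> *; apply: dsumP => n /=; rewrite ractDr. Qed.
Next Obligation. by move=> *; apply: dsumP => n /=; rewrite ractM. Qed.
Next Obligation. by move=> *; apply: dsumP => n /=; rewrite ract1. Qed.
Next Obligation. by move=> *; apply: dsumP => n /=; rewrite lract. Qed.
Next Obligation. by move=> *; apply: dsumP => n /=; rewrite corr_scal. Qed.
Next Obligation.
move=> x y z; have [N xyN] := dbound2 x y.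
rewrite !(@dformE N); try by move=> n /xyN [xn yn]; rewrite /= ?xn ?yn ?addr0.
by rewrite -big_split; apply: eq_bigr => n _; rewrite /= formDl.
Qed.
Next Obligation.
move=> x y a; have [N xN] := dvalP x.
rewrite !(@dformE N) //; last by move=> n /xN /= ->; rewrite ract0.
by rewrite mulr_suml; apply: eq_bigr => n _; rewrite /= form_ract.
Qed.
Next Obligation.
move=> x y; have [N xyN] := dbound2 x y.
rewrite !(@dformE N); try by move=> n /xyN [].
by rewrite star_sum; apply: eq_bigr => n _; rewrite /= -form_star.
Qed.
Next Obligation.
move=> b x y; have [N xN] := dvalP x.
rewrite !(@dformE N) //; last by move=> n /xN /= ->; rewrite lact0.
by apply: eq_bigr => n _; rewrite /= form_lact.
Qed.

End DirectSum.

Section DirectSum2.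
Context {R : realType} {B A : cstarAlgType R} (M N : corr B A).

Program Definition corr_sum : corr B A :=
  @Corr R B A (M * N)%type (fun b x => (b ▷ x.1, b ▷ x.2))
    (fun x a => (x.1 ◁ a, x.2 ◁ a))
    (fun x y => ⟨x.1, y.1⟩ + ⟨x.2, y.2⟩) _ _ _ _ _ _ _ _ _ _ _ _ _ _.
Next Obligation. by move=> * /=; rewrite !lactDl. Qed.
Next Obligation. by move=> * /=; rewrite !lactDr. Qed.
Next Obligation. by move=> * /=; rewrite !lactM. Qed.
Next Obligation. by move=> [x y] /=; rewrite !lact1. Qed.
Next Obligation. by move=> * /=; rewrite !ractDl. Qed.
Next Obligation. by move=> * /=; rewrite !ractDr. Qed.
Next Obligation. by move=> * /=; rewrite !ractM. Qed.
Next Obligation. by move=> [x y] /=; rewrite !ract1. Qed.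
Next Obligation. by move=> * /=; rewrite !lract. Qed.
Next Obligation. by move=> * /=; rewrite !corr_scal. Qed.
Next Obligation. by move=> * /=; rewrite !formDl addrACA. Qed.
Next Obligation. by move=> * /=; rewrite !form_ract mulrDl. Qed.
Next Obligation. by move=> * /=; rewrite starD -!form_star. Qed.
Next Obligation. by move=> * /=; rewrite !form_lact. Qed.

End DirectSum2.

Section Fock.
Context {R : realType} {B : cstarAlgType R} (H : corr B B).

(* H^{⊗0} = B, H^{⊗1} = H and H^{⊗(n+2)} = H ⊗_B H^{⊗(n+1)}. *)
Fixpoint hpow (n : nat) : corr B B :=
  match n with
  | 0 => self_corr B
  | n1.+1 => match n1 with 0 => H | _.+1 => tens H (hpow n1) end
  end.

Definition fock : corr B B := dsum hpow.

(* f ⊗ x; for n = 0 this is α |-> f α. *)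
Program Definition hcreate0 (f : H) : rlin (self_corr B) H :=
  @RLin _ _ _ (self_corr B) H (fun α => f ◁ α) _ _.
Next Obligation. by move=> f x y /=; rewrite ractDr. Qed.
Next Obligation. by move=> f x a /=; rewrite ractM. Qed.

Program Definition hcreateS (f : H) (N : corr B B) : rlin N (tens H N) :=
  @RLin _ _ _ N (tens H N) (fun x => f ⊗ x) _ _.
Next Obligation. by move=> f N x y /=; rewrite tpureDr. Qed.
Next Obligation. by move=> f N x a /=; rewrite tliftE. Qed.

Definition hcreate (f : H) (n : nat) : rlin (hpow n) (hpow n.+1) :=
  match n with
  | 0 => hcreate0 f
  | m.+1 => hcreateS f (hpow m.+1)
  end.

(* f ⊗ x |-> <f, ξ> x; for n = 0 this is f |-> <f, ξ>. *)
Program Definition hann0 (ξ : H) : rlin H (self_corr B) :=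
  @RLin _ _ _ H (self_corr B) (fun f => ⟨f, ξ⟩) _ _.
Next Obligation. by move=> ξ x y /=; rewrite formDl. Qed.
Next Obligation. by move=> ξ x a /=; rewrite form_ract. Qed.

Program Definition annb (ξ : H) (N : corr B B) : balanced (M := H) (N := N) N :=
  @Balanced _ _ _ _ H N N (fun f x => ⟨f, ξ⟩ ▷ x) _ _ _.
Next Obligation. by move=> * /=; rewrite formDl lactDl. Qed.
Next Obligation. by move=> * /=; rewrite lactDr. Qed.
Next Obligation. by move=> * /=; rewrite form_ract lactM. Qed.

Program Definition hannS (ξ : H) (N : corr B B) : rlin (tens H N) N :=
  @RLin _ _ _ (tens H N) N (tlift (annb ξ N)) _ _.
Next Obligation. by move=> ξ N x y /=; rewrite tliftD. Qed.
Next Obligation.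
move=> ξ N q c; elim/(@tens_ind _ _ _ _ H N): q => [|p q hp hq|x y].
- by rewrite ract0 tlift0 ract0.
- by rewrite ractDl !tliftD ractDl hp hq.
- by rewrite [X in tlift _ X]tliftE !tliftE; exact: lract.
Qed.

Definition hann (ξ : H) (n : nat) : rlin (hpow n.+1) (hpow n) :=
  match n with
  | 0 => hann0 ξ
  | m.+1 => hannS ξ (hpow m.+1)
  end.

Program Definition rlin_zero (M N : corr B B) : rlin M N :=
  @RLin _ _ _ M N (fun => 0) _ _.
Next Obligation. by move=> M N x y /=; rewrite addr0. Qed.
Next Obligation. by move=> M N x a /=; rewrite ract0. Qed.

(* f ⊗ x |-> t(f) ⊗ x, and 0 on B. *)
Definition hfirst (t : rlin H H) (n : nat) : rlin (hpow n) (hpow n) :=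
  match n with
  | 0 => rlin_zero (self_corr B) (self_corr B)
  | n1.+1 => match n1 with
             | 0 => t
             | m.+1 => tmap (N := hpow m.+1) t
             end
  end.

Program Definition fock_create (ξ : H) : rlin fock fock :=
  @RLin _ _ _ fock fock (fun x : fock => @DSum _ _ _ hpow
    (fun n => match n return hpow n with 0 => 0 | m.+1 => hcreate ξ m (dval x m) end) _) _ _.
Next Obligation.
by move=> ξ x; have [N xN] := dvalP x; exists N.+1 => -[//|n] /xN /= ->; rewrite rlin0.
Qed.
Next Obligation.
by move=> ξ x y; apply: dsumP => -[|n] /=; rewrite ?addr0 // rlinD.
Qed.
Next Obligation.
by move=> ξ x a; apply: dsumP => -[|n]; rewrite /= ?mul0r // rlinR.
Qed.

Program Definition fock_ann (ξ : H) : rlin fock fock :=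
  @RLin _ _ _ fock fock (fun x : fock => @DSum _ _ _ hpow
    (fun n => hann ξ n (dval x n.+1)) _) _ _.
Next Obligation.
move=> ξ x; have [N xN] := dvalP x; exists N => n Nn.
by rewrite xN ?rlin0 // ltnW.
Qed.
Next Obligation. by move=> ξ x y; apply: dsumP => n; rewrite /= rlinD. Qed.
Next Obligation. by move=> ξ x a; apply: dsumP => n; rewrite /= rlinR. Qed.

Program Definition fock_first (t : rlin H H) : rlin fock fock :=
  @RLin _ _ _ fock fock (fun x : fock => @DSum _ _ _ hpow
    (fun n => hfirst t n (dval x n)) _) _ _.
Next Obligation.
by move=> t x; have [N xN] := dvalP x; exists N => n /xN /= ->; rewrite rlin0.
Qed.
Next Obligation. by move=> t x y; apply: dsumP => n; rewrite /= rlinD. Qed.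
Next Obligation. by move=> t x a; apply: dsumP => n; rewrite /= rlinR. Qed.

Program Definition fock_scalar (α : B) : fock := @DSum _ _ _ hpow
  (fun n => match n return hpow n with 0 => α | _.+1 => 0 end) _.
Next Obligation. by move=> α; exists 1%N => -[]. Qed.

End Fock.

Section Model.
Context {R : realType} {B D : cstarAlgType R} (i : unital_inclusion B D).
Context (H : corr B B) (K : corr D D).

Definition fockD : corr B D := tens (fock H) (restrict i (self_corr D)).
Definition fockK : corr B D := tens (fock H) (restrict i K).

(* 1 ⊗ Ω d is represented by d. *)
Definition omegaD : corr B D := restrict i (self_corr D).

Definition modE : corr B D := corr_sum (corr_sum fockD omegaD) fockK.

Definition vac (W : corr B D) (w : W) : tens (fock H) W := fock_scalar H 1 ⊗ w.

Definition inD (d : D) : modE := (vac (W := restrict i (self_corr D)) d, 0, 0).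
Definition inOmega (d : D) : modE := (0, d, 0).
Definition inK (ζ : K) : modE := (0, 0, vac (W := restrict i K) ζ).

(* The coefficient of a vector at the summand 1 ⊗ Ω D. *)
Definition omega_part (e : modE) : D := e.1.2.

(* The component at 1 ⊗ K = B ⊗_B K, identified with K by α ⊗ ζ |-> α ζ. *)
Program Definition vacKb :
    balanced (M := fock H) (N := restrict i K) (K : zmodType) :=
  @Balanced _ _ _ _ (fock H) (restrict i K) K
    (fun x ζ => i (dval x 0) ▷ ζ) _ _ _.
Next Obligation. by move=> * /=; rewrite rmorphD lactDl. Qed.
Next Obligation. by move=> * /=; rewrite lactDr. Qed.
Next Obligation. by move=> * /=; rewrite rmorphM lactM. Qed.

Definition vacK_part (e : modE) : K := tlift vacKb e.2.

Definition on_fock (g : rlin (fock H) (fock H)) (e : modE) : modE :=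
  (tmap g e.1.1, 0, tmap g e.2).

Definition op_a (ξ : H) : modE -> modE := on_fock (fock_ann ξ).
Definition op_astar (ξ : H) : modE -> modE := on_fock (fock_create ξ).
Definition op_p (t : rlin H H) : modE -> modE := on_fock (fock_first t).
Definition op_A (η : K) (e : modE) : modE := inOmega ⟨vacK_part e, η⟩.
Definition op_Astar (η : K) (e : modE) : modE := inK (η ◁ omega_part e).
Definition op_P (T : rlin K K) (e : modE) : modE := inK (T (vacK_part e)).
Definition op_I1 (e : modE) : modE := (e.1.1, 0, e.2).
Definition op_I2 (e : modE) : modE := inOmega (omega_part e).

Definition omega_lact (d : D) (e : modE) : modE := inOmega (d * omega_part e).

Definition op_X (ξ : H) (η : K) (t : rlin H H) (T : rlin K K)
    (lambda1 : B) (lambda2 : D) (e : modE) : modE :=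
  op_a ξ e + op_astar ξ e + op_p t e + lambda1 ▷ op_I1 e
  + op_A η e + op_Astar η e + op_P T e + omega_lact lambda2 (op_I2 e).

Definition phi (S : modE -> modE) : D := ⟨S (inD 1), inD 1⟩.
Definition theta (S : modE -> modE) : D := ⟨S (inOmega 1), inOmega 1⟩.

Definition monomial (S : modE -> modE) (b : seq B) : modE -> modE :=
  foldr (fun c W => S \o @lact _ _ _ modE c \o W) id b.

(* The value of phi on a monomial as an element of B, see phi_momentE. *)
Definition phi_moment (S : modE -> modE) (b : seq B) : B :=
  xget 0 [set c | i c = phi (monomial S b)]%classic.
Definition theta_moment (S : modE -> modE) (b : seq B) : D :=
  theta (monomial S b).

End Model.

(* A family of maps kappa_n, n >= 1, of n arguments is encoded as one map on
   lists.  Positions in b are counted from 0, so the argument b_(k+1) of the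
   usual formulas is b`_k. *)
Section Cumulants.
Context {R : realType} {B D : cstarAlgType R}.
Variables (phi : seq B -> B) (theta : seq B -> D).

(* b_(j+1) phi(X b_(j+2) ... X b_k) *)
Definition block (b : seq B) (j k : nat) : B :=
  b`_j * phi (drop j.+1 (take k b)).

Definition ordvals n (j : seq 'I_n) : seq nat := [seq val x | x <- j].

(* The sum over 0 = j_0 < j_1 < ... < j_p = n. *)
Definition free_term (kappa : seq B -> B) (b : seq B) (p : nat) : B :=
  let n := size b in
  \sum_(j : p.+1.-tuple 'I_n.+1 | [&& nth 0%N (ordvals j) 0 == 0%N,
          nth 0%N (ordvals j) p == n & sorted ltn (ordvals j)])
     kappa [seq block b (nth 0%N (ordvals j) s) (nth 0%N (ordvals j) s.+1)
           | s <- iota 0 p].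

(* The sum over 0 <= l_1 < ... < l_p = n - 1. *)
Definition cfree_term (ckappa : seq B -> D) (b : seq B) (p : nat) : D :=
  let n := size b in
  \sum_(l : p.-tuple 'I_n | (nth 0%N (ordvals l) p.-1 == n.-1) &&
          sorted ltn (ordvals l))
     theta (take (nth 0%N (ordvals l) 0) b) *
     ckappa (rcons [seq block b (nth 0%N (ordvals l) s) (nth 0%N (ordvals l) s.+1)
                   | s <- iota 0 p.-1] (last 0 b)).

(* The terms p = n are kappa b and ckappa b, so that these recursions determine
   kappa and ckappa on nonempty lists, see free_cumulants_exist_unique and
   cfree_cumulants_exist_unique; multilinearity is inherited from phi and
   theta. *)
Definition free_cumulants (kappa : seq B -> B) :=
  forall b, b != [::] -> phi b = \sum_(1 <= p < (size b).+1) free_term kappa b p.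

Definition cfree_cumulants (ckappa : seq B -> D) :=
  forall b, b != [::] ->
    theta b = \sum_(1 <= p < (size b).+1) cfree_term ckappa b p.

End Cumulants.

Section FockFacts.
Context {R : realType} {B : cstarAlgType R} (H : corr B B).

Lemma hann_create (ξ f : H) n (x : hpow H n) :
  hann ξ n (hcreate f n x) = ⟨f, ξ⟩ ▷ x.
Proof. by case: n x => [|n] x /=; rewrite ?form_ract // tliftE. Qed.

Lemma hfirst_create (t : rlin H H) (f : H) n (x : hpow H n) :
  hfirst t n.+1 (hcreate f n x) = hcreate (t f) n x.
Proof. by case: n x => [|n] x /=; rewrite ?rlinR // tliftE. Qed.

Lemma hpow_ind n (P : hpow H n.+1 -> Prop) :
  P 0 -> (forall x y, P x -> P y -> P (x + y)) ->
  (forall f x, P (hcreate f n x)) -> forall x, P x.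
Proof.
case: n P => [|n] P P0 PD Pc x /=.
  by move: (Pc x 1) => /=; rewrite ract1.
by elim/(@tens_ind _ _ _ _ H (hpow H n.+1)): x.
Qed.

Lemma hann_adj (ξ : H) n (x : hpow H n.+1) (y : hpow H n) :
  ⟨hann ξ n x, y⟩ = ⟨x, hcreate ξ n y⟩.
Proof.
case: n x y => [|n] x y; first by rewrite /= form_ractr.
elim/(@tens_ind _ _ _ _ H (hpow H n.+1)): x => [|p q hp hq|f x].
- by rewrite rlin0 !form0l.
- by rewrite rlinD !formDl hp hq.
- by rewrite [LHS](congr1 (fun z => ⟨z, y⟩) (tliftE _ _ _)) [RHS]tformE.
Qed.

Lemma tmap_adj (C A : cstarAlgType R) (M : corr C B) (N : corr B A)
    (g g' : rlin M M) : (forall x y, ⟨g x, y⟩ = ⟨x, g' y⟩) ->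
  forall x y : tens M N, ⟨tmap g x, y⟩ = ⟨x, tmap g' y⟩.
Proof.
move=> gg' x y; elim/(@tens_ind _ _ _ _ M N): x => [|p q hp hq|u v].
- by rewrite rlin0 !form0l.
- by rewrite rlinD !formDl hp hq.
elim/(@tens_ind _ _ _ _ M N): y => [|p q hp hq|u' v'].
- by rewrite rlin0 !form0r.
- by rewrite rlinD !formDr hp hq.
- by rewrite !tmapE ![LHS]tformE ![RHS]tformE gg'.
Qed.

Lemma hfirst_adj (t : rlin H H) : selfadjoint t ->
  forall n, selfadjoint (hfirst t n).
Proof.
move=> tS [|[|n]] x y; [by rewrite form0l form0r|exact: tS|exact: tmap_adj].
Qed.

Lemma fock_ann_adj (ξ : H) (x y : fock H) :
  ⟨fock_ann ξ x, y⟩ = ⟨x, fock_create ξ y⟩.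
Proof.
have [N xN] := dvalP x.
rewrite [RHS](dformE _ (N := N.+1)); last by move=> n /ltnW /xN.
rewrite [LHS](dformE _ (N := N)); last first.
  by move=> n Nn /=; rewrite xN ?rlin0 // ltnW.
rewrite big_ord_recl [X in _ = X + _]form0r add0r.
by apply: eq_bigr => k _; exact: hann_adj.
Qed.

Lemma fock_create_adj (ξ : H) (x y : fock H) :
  ⟨fock_create ξ x, y⟩ = ⟨x, fock_ann ξ y⟩.
Proof. by rewrite form_star -fock_ann_adj -form_star. Qed.

Lemma fock_first_adj (t : rlin H H) : selfadjoint t -> selfadjoint (fock_first t).
Proof.
move=> tS x y; have [N xN] := dvalP x.
rewrite [RHS](dformE _ (N := N)); last by move=> n /xN.
rewrite [LHS](dformE _ (N := N)); last by move=> n /xN /= ->; rewrite rlin0.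
by apply: eq_bigr => k _; exact: hfirst_adj.
Qed.

Lemma form_vac (x : fock H) : ⟨x, fock_scalar H 1⟩ = dval x 0 :> B.
Proof.
rewrite form_star [X in star X](dformE _ (N := 1)); last by case.
by rewrite big_ord_recl big_ord0 addr0 /= mulr1 starK.
Qed.

End FockFacts.

Section ModelFacts.
Context {R : realType} {B D : cstarAlgType R} (i : unital_inclusion B D).
Context (H : corr B B) (K : corr D D).
Local Notation E := (modE i H K).

Lemma vacK_part_inK (ζ : K) : vacK_part (inK i H ζ) = ζ.
Proof. by rewrite /vacK_part tliftE /= rmorph1 lact1. Qed.

Lemma form_inK (x : fockK i H K) (ζ : K) :
  ⟨x, vac H (W := restrict i K) ζ⟩ = ⟨tlift (vacKb i H K) x, ζ⟩.
Proof.
elim/(@tens_ind _ _ _ _ (fock H) (restrict i K)): x => [|p q hp hq|u v].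
- by rewrite tlift0 !form0l.
- by rewrite tliftD !formDl hp hq.
- by rewrite [LHS]tformE tliftE form_vac.
Qed.

Variables (ξ : H) (η : K) (t : adjointable H) (T : adjointable K).
Variables (lambda1 : B) (lambda2 : D).
Hypotheses (tS : selfadjoint t) (TS : selfadjoint T).
Hypotheses (l1S : star lambda1 = lambda1) (l2S : star lambda2 = lambda2).
Local Notation X := (op_X (i := i) ξ η t T lambda1 lambda2).

Lemma on_fock_adj (g g' : rlin (fock H) (fock H)) :
  (forall x y, ⟨g x, y⟩ = ⟨x, g' y⟩) ->
  forall x y : E, ⟨on_fock g x, y⟩ = ⟨x, on_fock g' y⟩.
Proof.
move=> gg' x y; rewrite /on_fock /=.
rewrite [X in X + _ + _](tmap_adj (N := restrict i (self_corr D)) gg').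
rewrite [X in _ + _ + X](tmap_adj (N := restrict i K) gg').
by rewrite mulr0 star0 mul0r.
Qed.

Lemma form_inKE (z : E) (ζ : K) : ⟨z, inK i H ζ⟩ = ⟨vacK_part z, ζ⟩.
Proof.
by rewrite -[RHS]form_inK -[RHS]add0r; congr (_ + _); rewrite /= tform0r star0 mul0r addr0.
Qed.

Lemma form_inOmega (z : E) (d : D) : ⟨z, inOmega i H K d⟩ = star d * omega_part z.
Proof. by rewrite /= !tform0r add0r addr0. Qed.

Lemma op_A_adj (x y : E) : ⟨op_A η x, y⟩ = ⟨x, op_Astar η y⟩.
Proof.
by rewrite form_star form_inOmega form_inKE starM starK -form_ractr.
Qed.

Lemma op_Astar_adj (x y : E) : ⟨op_Astar η x, y⟩ = ⟨x, op_A η y⟩.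
Proof. by rewrite form_star -op_A_adj -form_star. Qed.

Lemma op_P_adj (x y : E) : ⟨op_P T x, y⟩ = ⟨x, op_P T y⟩.
Proof. by rewrite form_star !form_inKE -form_star TS. Qed.

Lemma op_X_selfadjoint : selfadjoint X.
Proof.
move=> x y; rewrite /op_X !formDl !formDr.
rewrite (on_fock_adj (fock_ann_adj ξ)) (on_fock_adj (fock_create_adj ξ)).
rewrite (on_fock_adj (fock_first_adj tS)) op_A_adj op_Astar_adj op_P_adj.
have -> : ⟨lambda1 ▷ op_I1 x, y⟩ = ⟨x, lambda1 ▷ op_I1 y⟩.
  by rewrite form_lact l1S /= !mulr0 star0 !mul0r.
have -> : ⟨omega_lact lambda2 (op_I2 x), y⟩ = ⟨x, omega_lact lambda2 (op_I2 y)⟩.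
  by rewrite form_star !form_inOmega starM starK starM l2S mulrA.
rewrite -/(op_a ξ y) -/(op_astar ξ y).
do 2 congr (_ + _); rewrite [LHS]addrAC; do 4 congr (_ + _); exact: addrC.
Qed.

Lemma vacK_part_ract (x : E) a : vacK_part (x ◁ a) = vacK_part x ◁ a.
Proof.
case: x => [x1 x]; rewrite /vacK_part /=.
elim/(@tens_ind _ _ _ _ (fock H) (restrict i K)): x => [|p q hp hq|u v].
- by rewrite !tlift0 ract0.
- by rewrite !tliftD ractDl hp hq.
- by rewrite !tliftE /= lract.
Qed.

Lemma on_fock_ract g (x : E) a : on_fock g (x ◁ a) = on_fock g x ◁ a.
Proof.
rewrite /on_fock; congr (_, _, _); last 1 first.
- exact: (rlinR (tmap (N := restrict i K) g)).
- exact: (rlinR (tmap (N := restrict i (self_corr D)) g)).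
- by rewrite /= mul0r.
Qed.

Lemma on_fockD g (x y : E) : on_fock g (x + y) = on_fock g x + on_fock g y.
Proof. by rewrite /on_fock /= !tliftD; congr (_, _, _); rewrite addr0. Qed.

Lemma inKD (ζ ζ' : K) : inK i H (ζ + ζ') = inK i H ζ + inK i H ζ'.
Proof. by rewrite /inK /vac (tpureDr (N := restrict i K)); congr (_, _, _); rewrite addr0. Qed.

Lemma inK_ract (ζ : K) a : inK i H (ζ ◁ a) = inK i H ζ ◁ a.
Proof.
rewrite /inK /vac; congr (_, _, _); rewrite /= ?mul0r ?tliftE //.
exact/esym/tlift0.
Qed.

Lemma inOmegaD (d d' : D) : inOmega i H K (d + d') = inOmega i H K d + inOmega i H K d'.
Proof. by congr (_, _, _); rewrite addr0. Qed.

Lemma inOmega_ract (d : D) a : inOmega i H K (d * a) = inOmega i H K d ◁ a.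
Proof. by congr (_, _, _); rewrite /= tlift0. Qed.

Lemma op_I1_ract (x : E) a : op_I1 (x ◁ a) = op_I1 x ◁ a.
Proof. by congr (_, _, _); rewrite /= mul0r. Qed.

Lemma op_I1D (x y : E) : op_I1 (x + y) = op_I1 x + op_I1 y.
Proof. by congr (_, _, _); rewrite addr0. Qed.

Lemma op_X_ract (x : E) a : X (x ◁ a) = X x ◁ a.
Proof.
rewrite /op_X !ractDl -!on_fock_ract; congr (_ + _ + _ + _ + _).
- by rewrite -lract op_I1_ract.
- by rewrite /op_A vacK_part_ract form_ract inOmega_ract.
- by rewrite /op_Astar -inK_ract -ractM.
- by rewrite /op_P vacK_part_ract rlinR inK_ract.
- by rewrite /omega_lact -inOmega_ract -mulrA.
Qed.

Lemma op_X_add (x y : E) : X (x + y) = X x + X y.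
Proof.
rewrite /op_X [RHS]addrACA; congr (_ + _); last first.
  by rewrite /omega_lact -inOmegaD -mulrDr.
rewrite [RHS]addrACA; congr (_ + _); last first.
  by rewrite /op_P -inKD -rlinD /vacK_part tliftD.
rewrite [RHS]addrACA; congr (_ + _); last first.
  by rewrite /op_Astar -inKD -ractDr.
rewrite [RHS]addrACA; congr (_ + _); last first.
  by rewrite /op_A -inOmegaD -formDl /vacK_part tliftD.
rewrite [RHS]addrACA; congr (_ + _); last by rewrite op_I1D lactDr.
rewrite [RHS]addrACA; congr (_ + _); last exact: on_fockD.
by rewrite [RHS]addrACA; congr (_ + _); exact: on_fockD.
Qed.

Lemma op_X_adjointable : exists S : adjointable E, forall e, S e = X e.
Proof.
have XA : exists S : E -> E, forall x y, ⟨RLin op_X_add op_X_ract x, y⟩ = ⟨x, S y⟩.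
  by exists X => x y; exact: op_X_selfadjoint.
by exists (Adjointable XA).
Qed.

Let inT (x : fock H) : E := (x ⊗ (1 : restrict i (self_corr D)), 0, 0).

Let inTD x y : inT x + inT y = inT (x + y).
Proof. by rewrite /inT tpureDl; congr (_, _, _); rewrite addr0. Qed.

Let lact_inT (b : B) x : b ▷ inT x = inT (b ▷ x).
Proof. by congr (_, _, _); rewrite /= ?tliftE ?mulr0 ?tlift0. Qed.

Let on_fock_inT g x : on_fock g (inT x) = inT (g x).
Proof. by congr (_, _, _); rewrite ?tmapE ?rlin0. Qed.

Let op_X_inT x : X (inT x) =
  inT (fock_ann ξ x + fock_create ξ x + fock_first t x + lambda1 ▷ x).
Proof.
have v0 : vacK_part (inT x) = 0 by exact: tlift0.
have K0 : inK i H (0 : K) = 0 by rewrite /inK /vac (tpure0r (N := restrict i K)).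
have o0 : omega_part (inT x) = 0 by [].
rewrite /op_X /op_A /op_P /op_Astar v0 form0l rlin0 o0 ract0r K0.
rewrite /omega_lact /op_I2 o0 [omega_part _]/= mulr0 !addr0.
by rewrite /op_a /op_astar /op_p !on_fock_inT (lact_inT lambda1) !inTD.
Qed.

(* On the algebra generated by B and X, phi takes its values in B. *)
Lemma phi_momentE b : i (phi_moment X b) = phi (monomial X b).
Proof.
rewrite /phi_moment; case: xgetP => [c _ //|none].
suff [x Ex] : exists x, monomial X b (inD i H K 1) = inT x.
  case: (none (dval x 0)); rewrite /= /phi Ex /= tformE form_vac.
  by rewrite mulr0 tform0l !addr0 /= star1 mul1r mulr1.
elim: b {none} => [|c b [x IHx]]; first by exists (fock_scalar H 1).
rewrite -[monomial _ _ _]/(X (c ▷ monomial X b (inD i H K 1))).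
by rewrite IHx lact_inT op_X_inT; eexists.
Qed.

End ModelFacts.

Section CumulantFacts.
Context {R : realType} {B D : cstarAlgType R}.
Variables (phi : seq B -> B) (theta : seq B -> D).
Hypotheses (phi1 : phi [::] = 1) (theta1 : theta [::] = 1).

Lemma sorted_ordvals n (j : n.-tuple 'I_n) :
  sorted ltn (ordvals j) -> ordvals j = iota 0 n.
Proof.
move=> js; have ju : uniq (ordvals j) by apply: sorted_uniq js; [exact: ltn_trans|exact: ltnn].
apply: (irr_sorted_eq ltn_trans ltnn js (iota_ltn_sorted 0 n)).
have sub : {subset ordvals j <= iota 0 n}.
  by move=> k /mapP[x _ ->]; rewrite mem_iota /= add0n ltn_ord.
by have [] := uniq_min_size ju sub; rewrite size_iota size_map size_tuple.
Qed.

Lemma ordvals_ord n : ordvals (ord_tuple n) = iota 0 n.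
Proof. by rewrite /ordvals -val_enum_ord val_ord_tuple. Qed.

Lemma blockS b s : block phi b s s.+1 = b`_s.
Proof. by rewrite /block drop_oversize ?phi1 ?mulr1 // size_take_min geq_minl. Qed.

Lemma free_term_size kappa b : free_term phi kappa b (size b) = kappa b.
Proof.
rewrite /free_term /=; set n := size b.
rewrite (big_pred1 (ord_tuple n.+1)) => [|j].
  congr kappa; rewrite ordvals_ord -[RHS](mkseq_nth 0) /mkseq -/n.
  apply/eq_in_map => s; rewrite mem_iota add0n => /andP[_ sn].
  have sn1 : (s < n.+1)%N by exact: ltnW.
  by rewrite !nth_iota // !add0n blockS.
apply/and3P/eqP => [[_ _ js]|->].
  apply: val_inj; apply: (inj_map val_inj).
  by rewrite [LHS](sorted_ordvals js) -[RHS]/(ordvals _) ordvals_ord.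
by rewrite ordvals_ord !nth_iota // iota_ltn_sorted.
Qed.

Lemma cfree_term_size ckappa b : b != [::] ->
  cfree_term phi theta ckappa b (size b) = ckappa b.
Proof.
move=> b0; have n0 : (0 < size b)%N by rewrite lt0n size_eq0.
rewrite /cfree_term /=; set n := size b.
rewrite (big_pred1 (ord_tuple n)) => [|j].
  rewrite ordvals_ord nth_iota // take0 theta1 mul1r; congr ckappa.
  case/lastP: b @n n0 {b0} => [//|b x] n _; rewrite last_rcons; congr rcons.
  have -> : n = (size b).+1 by rewrite /n size_rcons.
  rewrite -[RHS](mkseq_nth 0) /mkseq; apply/eq_in_map => s.
  rewrite mem_iota add0n => /andP[_ sn]; have sn1 : (s < (size b).+1)%N by exact: ltnW.
  rewrite !nth_iota // !add0n.
  by rewrite blockS nth_rcons sn.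
apply/andP/eqP => [[_ js]|->].
  apply: val_inj; apply: (inj_map val_inj).
  by rewrite [LHS](sorted_ordvals js) -[RHS]/(ordvals _) ordvals_ord.
by rewrite ordvals_ord nth_iota ?iota_ltn_sorted ?prednK //= add0n.
Qed.

(* A recursion whose leading term is k b determines k on nonempty lists. *)
Lemma recursion_exist_unique (M : zmodType) (m : seq B -> M)
    (F : (seq B -> M) -> seq B -> nat -> M) :
  (forall k b, b != [::] -> F k b (size b) = k b) ->
  (forall k k' b p, (0 < p)%N ->
     (forall c, size c = p -> k c = k' c) -> F k b p = F k' b p) ->
  (exists k, forall b, b != [::] -> m b = \sum_(1 <= p < (size b).+1) F k b p) /\
  (forall k k',
     (forall b, b != [::] -> m b = \sum_(1 <= p < (size b).+1) F k b p) ->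
     (forall b, b != [::] -> m b = \sum_(1 <= p < (size b).+1) F k' b p) ->
     forall b, b != [::] -> k b = k' b).
Proof.
move=> Ftop Fext; split; last first.
  move=> k k' kP k'P b; have [n] := ubnP (size b).
  elim: n b => // n IHn b bn b0; have s0 : (0 < size b)%N by rewrite lt0n size_eq0.
  have := kP b b0; rewrite (k'P b b0) !big_nat_recr //= !Ftop //.
  rewrite (_ : \sum_(1 <= p < size b) F k' b p = \sum_(1 <= p < size b) F k b p).
    by move=> /addrI.
  apply: eq_big_nat => p /andP[p0 pb]; apply: Fext => // c cp; apply/esym/IHn.
    by rewrite cp (leq_trans pb).
  by rewrite -size_eq0 cp -lt0n.
pose fix kap (n : nat) : seq B -> M := fun b =>
  if n is n'.+1 then m b - \sum_(1 <= p < size b) F (kap n') b p else 0.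
pose k b := kap (size b) b.
have kapE n b : (size b <= n)%N -> b != [::] -> kap n b = k b.
  elim/ltn_ind: n b => n IHn b bn b0; rewrite /k.
  have s0 : (0 < size b)%N by rewrite lt0n size_eq0.
  case: n bn IHn => [|n] bn IHn; first by move: (leq_trans s0 bn).
  case E : (size b) s0 => [//|s] _ /=; rewrite E; congr (_ - _).
  apply: eq_big_nat => p /andP[p0 ps]; apply: Fext => // c cp.
  have c0 : c != [::] by rewrite -size_eq0 cp -lt0n.
  rewrite E ltnS in bn; have cs : (size c <= s)%N by rewrite cp -ltnS.
  by rewrite (IHn n) ?(leq_trans cs) // (IHn s) // ltnS.
exists k => b b0; have s0 : (0 < size b)%N by rewrite lt0n size_eq0.
rewrite big_nat_recr //= Ftop // {2}/k; case E : (size b) s0 => [//|s] _ /=.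
rewrite E [X in _ = X + _](_ : _ = \sum_(1 <= p < s.+1) F (kap s) b p); last first.
  apply: eq_big_nat => p /andP[p0 ps]; apply: Fext => // c cp.
  by rewrite kapE // ?cp // -size_eq0 cp -lt0n.
by rewrite addrCA subrr addr0.
Qed.

Lemma free_cumulants_exist_unique :
  (exists kappa, free_cumulants phi kappa) /\
  (forall kappa kappa', free_cumulants phi kappa -> free_cumulants phi kappa' ->
     forall b, b != [::] -> kappa b = kappa' b).
Proof.
apply: (@recursion_exist_unique _ phi (free_term phi)).
  by move=> k b _; exact: free_term_size.
move=> k k' b p _ kk'; apply: eq_bigr => j _; apply: kk'.
by rewrite size_map size_iota.
Qed.

Lemma cfree_cumulants_exist_unique :
  (exists ckappa, cfree_cumulants phi theta ckappa) /\
  (forall ckappa ckappa', cfree_cumulants phi theta ckappa ->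
     cfree_cumulants phi theta ckappa' ->
     forall b, b != [::] -> ckappa b = ckappa' b).
Proof.
apply: (@recursion_exist_unique _ theta (cfree_term phi theta)).
  by move=> k b; exact: cfree_term_size.
move=> k k' b p p0 kk'; apply: eq_bigr => j _; congr (_ * _); apply: kk'.
by rewrite size_rcons size_map size_iota prednK.
Qed.

End CumulantFacts.

(* Main.v *)
Require Import Defs.
From HB Require Import structures.
From mathcomp Require Import all_boot all_order all_algebra.
From mathcomp Require Import reals.

Set Implicit Arguments.
Unset Strict Implicit.
Unset Printing Implicit Defensive.
#[local] Obligation Tactic := idtac.

Import GRing.Theory.
Local Open Scope ring_scope.

(** The recursions determine the cumulants on nonempty words, so it is enough
that the right-hand sides of the theorem satisfy them.  Both have the shape
λ y for one letter and ⟨y_1 τ y_2 τ ... τ y_(n-1) (x y_n), x⟩ for more letters,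
with (x, τ) = (ξ, t) in H, respectively (η, T) in K: they are the maps
ladder_cumulant below.

The reason is the same in both cases.  Let S be the part of X made of a_ξ,
a_ξ^*, p(t) and λ_1, acting on T(H), let N be H or K, and let x_0 ∈ B be the
component in B of x ∈ T(H).  On vectors x ⊗ g of T(H) ⊗_B N,

  X (x ⊗ g) = S x ⊗ g + 1 ⊗ τ(x_0 g) + (a vector determined by ⟨x_0 g, x_N⟩),

where x_N is ξ or η.  For N = K this is the definition of P(T) and A_η, and the
last term lies in Ω D.  For N = H the space T(H) ⊗_B H is identified with the
complement of B in T(H), and S takes the place of X; p(t) and a_ξ see the last
factor g only if no other factor stands on its left, and the last term lies in
B (fock_X_append).

Hence a letter of a word X b_1 ... X b_n touches the factor in N only if the
letters since the previous such time have brought the left factor back to B.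
These letters act on the left factor alone, starting from 1, so what they
contribute is φ of the corresponding subword.  The expansion of the word by the
times at which N is touched is then a sum over increasing sequences of
positions, in which the subwords between consecutive times enter only through
the elements b φ(X b' ... X b'') of the recursions, separated by τ.  This
bookkeeping is done once, for N and X abstract, in excursions_step: with the
source a_ξ^* it gives the free recursion (fock_free_cumulants), and with the
initial vector A_η^* b_n (1 ⊗ Ω) it gives the c-free one
(run_excursions, model_cfree_cumulants). *)

(** * Sums over increasing sequences of positions *)

Lemma morph_add0 (U V : zmodType) (f : U -> V) :
  {morph f : x y / x + y} -> f 0 = 0.
Proof. by move=> fD; apply: (addrI (f 0)); rewrite -fD !addr0. Qed.

Lemma morph_sum (U V : zmodType) (f : U -> V) (fD : {morph f : x y / x + y})
    I (r : seq I) (P : pred I) (F : I -> U) :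
  f (\sum_(k <- r | P k) F k) = \sum_(k <- r | P k) f (F k).
Proof. exact: (big_morph f fD (morph_add0 fD)). Qed.

Lemma big_tuple_cons (T : finType) (M : zmodType) {p} (P : pred (seq T))
    (F : seq T -> M) :
  \sum_(j : p.+1.-tuple T | P j) F j =
  \sum_x \sum_(j : p.-tuple T | P (x :: j)) F (x :: j).
Proof.
rewrite pair_big_dep /=.
pose h (q : T * p.-tuple T) : p.+1.-tuple T := [tuple of q.1 :: q.2].
rewrite (reindex h); first by [].
exists (fun j : p.+1.-tuple T => (thead j, [tuple of behead j])).
  by move=> [x j] _; rewrite /h theadE; congr pair; apply: val_inj.
by move=> j _; rewrite /h [RHS]tuple_eta.
Qed.

Section ChainSums.
Variables (e : nat) (M : zmodType).

(** No chain has more than e steps, so that bounding p loses nothing.  As the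
bound is the same for all a, the first index can be split off without changing
the range of p. *)
Definition chain_sum (F : seq nat -> M) (a : nat) : M :=
  \sum_(p < e.+1) \sum_(j : p.-tuple 'I_e.+1 |
    path ltn a (ordvals j) && (last a (ordvals j) == e)) F (ordvals j).

Lemma path_ltn_size a s : path ltn a s -> (a + size s <= last a s)%N.
Proof.
elim: s a => [|x s IHs] a /=; first by rewrite addn0.
by case/andP=> ax /IHs; apply: leq_trans; rewrite addnS -addSn leq_add2r.
Qed.

Lemma chain_sum_rec F a :
  chain_sum F a = (if a == e then F [::] else 0) +
    \sum_(k < e.+1 | (a < k)%N) chain_sum (fun j => F (val k :: j)) k.
Proof.
pose W p (G : seq nat -> M) c := \sum_(j : p.-tuple 'I_e.+1 |
  path ltn c (ordvals j) && (last c (ordvals j) == e)) G (ordvals j).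
have W0 : W 0%N F a = if a == e then F [::] else 0.
  rewrite /W big_mkcond (big_pred1 [tuple]) //= => j.
  by apply/esym/eqP; exact: tuple0.
have WS p : W p.+1 F a =
    \sum_(k < e.+1 | (a < k)%N) W p (fun j => F (val k :: j)) k.
  rewrite /W (big_tuple_cons
    (fun j : seq 'I_e.+1 => path ltn a (ordvals j) && (last a (ordvals j) == e))
    (fun j => F (ordvals j))) [RHS]big_mkcond /=.
  apply: eq_bigr => k _; case: ifP => // _.
  by rewrite big_pred0.
have top : W e.+1 F a = 0.
  (* e.+1 strict steps starting at a do not fit below e *)
  rewrite /W big_pred0 // => j; apply/negP => /andP[/path_ltn_size aj /eqP je].
  by move: aj; rewrite je size_map size_tuple addnS ltnNge leq_addl.
(* Adding the empty term p = e.+1 makes room for the shift p -> p.+1. *)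
have -> : chain_sum F a = \sum_(p < e.+2) W p F a.
  by rewrite big_ord_recr /= top addr0.
rewrite big_ord_recl W0; congr (_ + _).
by rewrite exchange_big; apply: eq_bigr => p _; exact: WS.
Qed.

Lemma eq_chain_sum F F' a : F =1 F' -> chain_sum F a = chain_sum F' a.
Proof. by move=> FF'; do 2 apply: eq_bigr => ? _; exact: FF'. Qed.

Lemma chain_sumD F F' a :
  chain_sum (fun j => F j + F' j) a = chain_sum F a + chain_sum F' a.
Proof. by rewrite -big_split; apply: eq_bigr => p _; rewrite -big_split. Qed.

Lemma chain_sum_nil (x : M) a :
  chain_sum (fun j => if j is [::] then x else 0) a = if a == e then x else 0.
Proof.
rewrite chain_sum_rec big1 ?addr0 // => k _.
by rewrite /chain_sum big1 // => p _; rewrite big1.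
Qed.

End ChainSums.

Lemma morph_chain_sum e (U V : zmodType) (f : U -> V)
    (fD : {morph f : x y / x + y}) F a :
  f (chain_sum e F a) = chain_sum e (fun j => f (F j)) a.
Proof.
by rewrite (morph_sum fD); apply: eq_bigr => p _; rewrite (morph_sum fD).
Qed.

Section RecursionsAsChainSums.
Context {R : realType} {B D : cstarAlgType R}.
Variables (phi : seq B -> B) (theta : seq B -> D) (b : seq B).

Lemma blocks_pairmap a s n : size s = n ->
  [seq block phi b (nth 0%N (a :: s) k) (nth 0%N (a :: s) k.+1)
  | k <- iota 0 n] = pairmap (block phi b) a s.
Proof.
move=> <- {n}; elim: s a => [|x s IHs] a //=; congr cons.
by rewrite -[RHS]IHs -[1%N]addn0 iotaDl -map_comp; apply: eq_map.
Qed.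

Lemma nth_last_cons (a : nat) s n : size s = n -> nth 0%N (a :: s) n = last a s.
Proof. by move=> <-; rewrite -[size s]/((size (a :: s)).-1) nth_last. Qed.

(** The index j_0 = 0 is constant, hence not part of the chain. *)
Lemma free_terms_chain_sum kappa : b != [::] ->
  \sum_(1 <= p < (size b).+1) free_term phi kappa b p =
  chain_sum (size b) (fun j => kappa (pairmap (block phi b) 0 j)) 0.
Proof.
move=> b0; have n0 : (0 < size b)%N by rewrite lt0n size_eq0.
rewrite big_add1 big_mkord /chain_sum [RHS]big_ord_recl.
rewrite [X in _ = X + _]big_pred0 ?add0r => [|j]; last first.
  by have -> : j = [tuple] by [exact: tuple0]; rewrite /= eq_sym (gtn_eqF n0).
apply: eq_bigr => p _.
rewrite /free_term (big_tuple_cons (fun j : seq 'I_(size b).+1 =>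
    [&& nth 0%N (ordvals j) 0 == 0%N, nth 0%N (ordvals j) p.+1 == size b & sorted ltn (ordvals j)])
  (fun j => kappa [seq block phi b (nth 0%N (ordvals j) s) (nth 0%N (ordvals j) s.+1)
           | s <- iota 0 p.+1])).
rewrite (bigD1 ord0) //= [X in _ + X]big1 ?addr0 => [|k k0].
  have sz (j : p.+1.-tuple 'I_(size b).+1) : size (ordvals j) = p.+1.
    by rewrite size_map size_tuple.
  apply: eq_big => [j|j _].
    by rewrite /= -(nth_last_cons 0 (sz j)) andbC.
  by rewrite -(blocks_pairmap 0 (sz j)).
by rewrite big_pred0 // => j; rewrite -[(k : nat) == 0%N]/(k == ord0) (negbTE k0).
Qed.

(** The index l_1 starts the chain and is summed outside, as the prefix moment
depends on it only. *)
Lemma cfree_terms_chain_sum ckappa e : size b = e.+1 ->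
  \sum_(1 <= p < (size b).+1) cfree_term phi theta ckappa b p =
  \sum_(l < e.+1) theta (take l b) * chain_sum e
    (fun j => ckappa (rcons (pairmap (block phi b) l j) (last 0 b))) l.
Proof.
move=> be; rewrite big_add1 /= {1}be big_mkord.
under [RHS]eq_bigr => l _ do rewrite mulr_sumr.
rewrite [RHS]exchange_big; apply: eq_bigr => p _.
rewrite /cfree_term be (big_tuple_cons (fun l : seq 'I_e.+1 => (nth 0%N (ordvals l) p == e) &&
          sorted ltn (ordvals l)) (fun l =>
     theta (take (nth 0%N (ordvals l) 0) b) *
     ckappa (rcons [seq block phi b (nth 0%N (ordvals l) s) (nth 0%N (ordvals l) s.+1)
                   | s <- iota 0 p] (last 0 b)))) /=.
apply: eq_bigr => l _; rewrite mulr_sumr.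
have sz (j : p.-tuple 'I_e.+1) : size (ordvals j) = p by rewrite size_map size_tuple.
apply: eq_big => [j|j _].
  by rewrite (nth_last_cons _ (sz j)) andbC.
by rewrite -(blocks_pairmap _ (sz j)).
Qed.

End RecursionsAsChainSums.

(** * Tensoring on the right in the Fock module *)

Section RightCreation.
Context {R : realType} {B : cstarAlgType R}.

(** The map f ⊗ x |-> f ⊗ h x is well defined on the balanced tensor product if
h is left linear; bundling this property lets such maps be iterated along the
tensor powers. *)
Record llin (M N : corr B B) := LLin {
  lfun :> M -> N ;
  llinD : {morph lfun : x y / x + y} ;
  llinL : forall b x, lfun (b ▷ x) = b ▷ lfun x }.

Lemma llin0 (M N : corr B B) (h : llin M N) : h 0 = 0.
Proof. exact: (morph_add0 (llinD h)). Qed.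

Section LeftLinearTensor.
Context {H M N : corr B B} (h : llin M N).

Program Definition ltmapb : balanced (M := H) (N := M) (tens H N) :=
  @Balanced _ _ _ _ H M (tens H N) (fun f x => f ⊗ h x) _ _ _.
Next Obligation. by move=> * /=; rewrite tpureDl. Qed.
Next Obligation. by move=> * /=; rewrite llinD tpureDr. Qed.
Next Obligation. by move=> * /=; rewrite llinL tpureM. Qed.

Program Definition ltmap : llin (tens H M) (tens H N) :=
  @LLin (tens H M) (tens H N) (tlift ltmapb) _ _.
Next Obligation. by move=> x y; rewrite tliftD. Qed.
Next Obligation.
move=> b q; elim/(@tens_ind _ _ _ _ H M): q => [|p q hp hq|x y].
- by rewrite lact0 !tlift0 lact0.
- by rewrite lactDr !tliftD lactDr hp hq.
- by do !rewrite tliftE /=.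
Qed.

Lemma ltmapE f x : ltmap (f ⊗ x) = f ⊗ h x.
Proof. exact: tliftE. Qed.

End LeftLinearTensor.

Variable H : corr B B.

Program Definition rcreate0 (g : H) : llin (self_corr B) H :=
  @LLin (self_corr B) H (fun α => α ▷ g) _ _.
Next Obligation. by move=> g x y /=; rewrite lactDl. Qed.
Next Obligation. by move=> g b x /=; rewrite lactM. Qed.

Program Definition rcreate1 (g : H) : llin H (tens H H) :=
  @LLin H (tens H H) (fun f => f ⊗ g) _ _.
Next Obligation. by move=> g x y /=; rewrite tpureDl. Qed.
Next Obligation. by move=> g b x /=; rewrite tliftE. Qed.

(** The map x |-> x ⊗ g.  Tensor powers associate to the right, so that g has to
be carried to the innermost position. *)
Fixpoint rcreate (g : H) (n : nat) : llin (hpow H n) (hpow H n.+1) :=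
  match n with
  | 0 => rcreate0 g
  | n1.+1 =>
    match n1 return llin (hpow H n1) (hpow H n1.+1) ->
                    llin (hpow H n1.+1) (hpow H n1.+2) with
    | 0 => fun => rcreate1 g
    | m.+1 => fun h => ltmap h
    end (rcreate g n1)
  end.

Lemma rcreate_hcreate (f g : H) n (x : hpow H n) :
  rcreate g n.+1 (hcreate f n x) = hcreate f n.+1 (rcreate g n x).
Proof. by case: n x => [|n] x /=; rewrite ?tpureM // tliftE. Qed.

(** Annihilation, like p(t) below, acts on the first factor only, hence commutes
with tensoring on the right as soon as a first factor is present before. *)
Lemma hann_rcreate (ξ g : H) n (x : hpow H n.+1) :
  hann ξ n.+1 (rcreate g n.+1 x) = rcreate g n (hann ξ n x).
Proof.
elim/(@hpow_ind _ _ H n): x => [|x y hx hy|f x]; first by rewrite llin0 !rlin0 llin0.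
  by rewrite llinD !rlinD llinD hx hy.
by rewrite rcreate_hcreate !hann_create llinL.
Qed.

Lemma hfirst_rcreate (t : rlin H H) (g : H) n (x : hpow H n.+1) :
  hfirst t n.+2 (rcreate g n.+1 x) = rcreate g n.+1 (hfirst t n.+1 x).
Proof.
elim/(@hpow_ind _ _ H n): x => [|x y hx hy|f x]; first by rewrite llin0 !rlin0 llin0.
  by rewrite llinD !rlinD llinD hx hy.
by rewrite rcreate_hcreate !hfirst_create rcreate_hcreate.
Qed.

(** The vector x ⊗ g of T(H), where B ⊗ H is identified with H. *)
Program Definition append (x : fock H) (g : H) : fock H :=
  @DSum _ _ _ (hpow H)
    (fun n => match n return hpow H n with 0 => 0 | m.+1 => rcreate g m (dval x m) end) _.
Next Obligation.
by move=> x g; have [N xN] := dvalP x; exists N.+1 => -[//|n] /xN /= ->; rewrite llin0.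
Qed.

Lemma append_lact b x g : b ▷ append x g = append (b ▷ x) g.
Proof. by apply: dsumP => -[|n] /=; rewrite ?mulr0 // llinL. Qed.

Lemma append_vacD : {morph append (fock_scalar H 1) : g g' / g + g'}.
Proof.
move=> g g' /=; apply: dsumP => -[|[|n]].
- by rewrite /= addr0.
- by rewrite /= lactDr.
have h f : append (fock_scalar H 1) f n.+2 = 0 by exact: llin0.
by rewrite -[RHS]/(append _ g n.+2 + append _ g' n.+2) !h addr0.
Qed.

Variables (ξ : H) (t : rlin H H) (lambda : B).

(** The restriction of X to T(H) ⊗ 1. *)
Definition fock_X (x : fock H) : fock H :=
  fock_ann ξ x + fock_create ξ x + fock_first t x + lambda ▷ x.

Lemma fock_XD : {morph fock_X : x y / x + y}.
Proof.
move=> x y; rewrite /fock_X !rlinD lactDr.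
by rewrite [RHS]addrACA; congr (_ + _); rewrite [RHS]addrACA; congr (_ + _);
  rewrite [RHS]addrACA.
Qed.

Lemma fock_scalarD : {morph fock_scalar H : α β / α + β}.
Proof. by move=> α β /=; apply: dsumP => -[|n] //=; rewrite addr0. Qed.

(** Creation and the scalar λ never reach g.  The operators a_ξ and p(t) reach it
exactly on the component x_0 ⊗ g = x_0 g, which has no other factor in H. *)
Lemma fock_X_append x g :
  fock_X (append x g) = append (fock_X x) g
    + append (fock_scalar H 1) (t (dval x 0%N ▷ g))
    + fock_scalar H ⟨dval x 0%N ▷ g, ξ⟩.
Proof.
have scal0 α m : fock_scalar H α m.+1 = 0 by [].
have vac0 f m : append (fock_scalar H 1) f m.+2 = 0 by exact: llin0.
apply: dsumP => -[|[|n]].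
- by rewrite /= mulr0 !addr0 !add0r.
- rewrite -[LHS]/(hann ξ 1 (rcreate g 1 (dval x 1%N)) + hcreate ξ 0 0
    + hfirst t 1 (rcreate g 0 (dval x 0%N)) + lambda ▷ rcreate g 0 (dval x 0%N)).
  rewrite hann_rcreate rlin0 addr0 -llinL.
  rewrite -[RHS]/(rcreate g 0 (hann ξ 0 (dval x 1%N) + 0 + 0 + lambda ▷ dval x 0%N)
    + 1 ▷ t (rcreate g 0 (dval x 0%N)) + 0).
  by rewrite !addr0 lact1 llinD -!addrA; congr (_ + _); rewrite addrC.
- rewrite -[LHS]/(hann ξ n.+2 (rcreate g n.+2 (dval x n.+2))
    + hcreate ξ n.+1 (rcreate g n (dval x n))
    + hfirst t n.+2 (rcreate g n.+1 (dval x n.+1))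
    + lambda ▷ rcreate g n.+1 (dval x n.+1)).
  rewrite hann_rcreate -rcreate_hcreate hfirst_rcreate -llinL -!llinD.
  rewrite -[RHS]/(rcreate g n.+1 (hann ξ n.+1 (dval x n.+2)
    + hcreate ξ n (dval x n) + hfirst t n.+1 (dval x n.+1)
    + lambda ▷ dval x n.+1) + append (fock_scalar H 1) _ n.+2 + fock_scalar H _ n.+2).
  by rewrite vac0 scal0 !addr0.
Qed.

Lemma fock_X_scalar α :
  fock_X (fock_scalar H α) =
  append (fock_scalar H 1) (ξ ◁ α) + fock_scalar H (lambda * α).
Proof.
have scal0 β m : fock_scalar H β m.+1 = 0 by [].
have vac0 f m : append (fock_scalar H 1) f m.+2 = 0 by exact: llin0.
apply: dsumP => -[|[|n]].
- by rewrite -[LHS]/(⟨0 : H, ξ⟩ + 0 + 0 + lambda * α) Defs.form0l !addr0.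
- rewrite -[LHS]/(hann ξ 1 0 + ξ ◁ α + t 0 + lambda ▷ 0) !rlin0 lact0.
  by rewrite !addr0 add0r -[RHS]/(1 ▷ (ξ ◁ α) + 0) lact1 addr0.
- rewrite -[LHS]/(hann ξ n.+2 0 + hcreate ξ n.+1 0 + hfirst t n.+2 0 + lambda ▷ 0).
  rewrite -[RHS]/(append (fock_scalar H 1) _ n.+2 + fock_scalar H _ n.+2).
  by rewrite !rlin0 lact0 !addr0 vac0.
Qed.

End RightCreation.

(** * Peeling the first block of a chain *)

Section ChainPeel.
Context {R : realType} {B A : cstarAlgType R} {N : corr B A}.
Variables (blk : nat -> nat -> B) (e : nat).

(** If blk cuts a word into the blocks of the recursions, their sums are values
of this form with F a cumulant. *)
Definition chain_val (U : zmodType) (F : seq B -> U) (a : nat) : U :=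
  chain_sum e (fun j => F (pairmap blk a j)) a.

Definition chain_tail (V : nat -> N) (a : nat) : N :=
  \sum_(k < e.+1 | (a < k)%N) blk a k ▷ V k.

(** The first block goes up to an index k, and the rest is a chain starting at k;
only if k = e is there no further block, which is what s accounts for. *)
Lemma chain_val_peel (U : zmodType) (F : seq B -> U) (f : N -> U) (s : B -> U)
    (G : seq B -> N) (fD : {morph f : x y / x + y}) :
  (forall z zs, F (z :: zs) = f (z ▷ G zs) + if zs is [::] then s z else 0) ->
  forall a, chain_val F a = (if a == e then F [::] else 0)
    + f (chain_tail (chain_val G) a) + (if (a < e)%N then s (blk a e) else 0).
Proof.
move=> Fcons a; rewrite /chain_val chain_sum_rec -addrA; congr (_ + _).
have step (k : 'I_e.+1) :
    chain_sum e (fun j => F (pairmap blk a (val k :: j))) k =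
    f (blk a k ▷ chain_val G k) + (if k == e :> nat then s (blk a k) else 0).
  have gD : {morph (fun x => f (blk a k ▷ x)) : x y / x + y}.
    by move=> x y /=; rewrite lactDr fD.
  have -> : f (blk a k ▷ chain_val G k) =
      chain_sum e (fun j => f (blk a k ▷ G (pairmap blk k j))) k.
    exact: (@morph_chain_sum e _ _ _ gD (fun j => G (pairmap blk k j)) k).
  rewrite -chain_sum_nil.
  rewrite -chain_sumD; apply: eq_chain_sum => j /=.
  by rewrite Fcons; case: j.
under eq_bigr => k _ do rewrite step.
rewrite big_split /= (morph_sum fD); congr (_ + _).
case: ifPn => ae; last first.
  by rewrite big1 // => k ak; case: eqP => // ke; rewrite -ke ak in ae.
rewrite (bigD1 ord_max) //= eqxx big1 ?addr0 // => k /andP[_ ke].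
by rewrite -[(k : nat) == e]/(k == ord_max) (negbTE ke).
Qed.

End ChainPeel.

Definition run (R : realType) (B A : cstarAlgType R) (M : corr B A)
    (Y : M -> M) (v : M) (r : seq B) : M := foldr (fun c z => Y (c ▷ z)) v r.

Section Run.
Context {R : realType} {B A : cstarAlgType R} {M : corr B A}.
Variables (Y : M -> M) (YD : {morph Y : x y / x + y}).

Lemma runD r : {morph run Y ^~ r : v v' / v + v'}.
Proof. by move=> v v'; elim: r => //= c r ->; rewrite lactDr YD. Qed.

Lemma run_rcons v r c : run Y v (rcons r c) = run Y (Y (c ▷ v)) r.
Proof. by rewrite /run -cats1 foldr_cat. Qed.

End Run.

Lemma drop_take_cons (T : Type) (x0 : T) (s : seq T) a k :
  (a < k)%N -> (k <= size s)%N ->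
  drop a (take k s) = nth x0 s a :: drop a.+1 (take k s).
Proof.
by move=> ak ks; rewrite (drop_nth x0) ?nth_take // size_takel.
Qed.

Lemma drop_take_id (T : Type) (s : seq T) k : drop k (take k s) = [::].
Proof. by rewrite drop_oversize // size_take_min geq_minl. Qed.

(** * Expanding a word by the times at which the right factor is touched *)

Section Transfer.
Context {R : realType} {B A : cstarAlgType R} {H : corr B B} {M N : corr B A}.
Variables (S : fock H -> fock H) (Y : M -> M) (τ : N -> N) (out : N -> M).
(* J x g stands for x ⊗ g, and out g for the part of Y (1 ⊗ g) which leaves
   T(H) ⊗ N. *)
Variables (J : fock H -> N -> M).
Hypotheses (YD : {morph Y : x y / x + y}) (τD : {morph τ : x y / x + y}).
Hypotheses (outD : {morph out : x y / x + y}).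
Hypothesis (J_lact : forall b x g, b ▷ J x g = J (b ▷ x) g).
Local Notation vacuum := (fock_scalar H 1).
Hypothesis (J1D : {morph J vacuum : g g' / g + g'}).
Hypothesis (YJ : forall x g, Y (J x g) =
  J (S x) g + J vacuum (τ (dval x 0%N ▷ g)) + out (dval x 0%N ▷ g)).

Definition vmoment (r : seq B) : B := dval (run S vacuum r) 0%N.

Variables (b : seq B) (e : nat) (eb : (e <= size b)%N).
Local Notation word a k := (drop a (take k b)).
Local Notation blk := (block vmoment b).

(* V a collects what the letters from position a on make of the factor in N just
   after it is touched at position a.  It comes from the initial vector g0 at
   the end of the word, from τ after an earlier visit at some k > a, or is
   created out of the scalars by the source σ. *)
Variables (V : nat -> N) (g0 : N) (σ : B -> N).
Local Notation Q := (chain_tail blk e V).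
Hypothesis VE : forall a, V a = (if a == e then g0 else 0) + τ (Q a)
  + (if (a < e)%N then σ (blk a e) else 0).

(** The component in T(H) ⊗ N of the result of the letters from position a on.
The term k gathers what was last touched in N at position k: the letters
between a and k have acted on the left factor only, starting from 1. *)
Definition excursions (a : nat) : M :=
  \sum_(k < e.+1 | (a <= k)%N) J (run S vacuum (word a k)) (V k).

Lemma chain_tail_end : Q e = 0.
Proof. by rewrite /chain_tail big1 // => k; rewrite ltnNge leq_ord. Qed.

Lemma excursions_end : excursions e = J vacuum g0.
Proof.
rewrite /excursions (big_pred1 ord_max) => [|k]; last first.
  by rewrite /= -[RHS]/((k : nat) == e) eqn_leq leq_ord.
by rewrite drop_take_id VE eqxx chain_tail_end (morph_add0 τD) ltnn !addr0.
Qed.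

(** One more letter acts on each left factor by S, which keeps k, and on its
component in B also by τ and out.  As these components are the moments of the
subwords, the contributions of τ over all k add up to the new term k = a, and
those of out to Q a. *)
Lemma excursions_step a : (a < e)%N ->
  Y (b`_a ▷ excursions a.+1) + J vacuum (σ (blk a e)) = excursions a + out (Q a).
Proof.
move=> ae; have ae1 : (a < e.+1)%N by exact: ltnW.
have lD : {morph (@lact _ _ _ M b`_a) : x y / x + y} by move=> x y; rewrite lactDr.
rewrite /excursions (morph_sum lD) (morph_sum YD).
have step (k : 'I_e.+1) : (a < k)%N ->
    Y (b`_a ▷ J (run S vacuum (word a.+1 k)) (V k)) =
    J (run S vacuum (word a k)) (V k) +
    (J vacuum (τ (blk a k ▷ V k)) + out (blk a k ▷ V k)).
  move=> ak; rewrite (drop_take_cons 0 ak (leq_trans (leq_ord k) eb)).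
  by rewrite J_lact YJ -addrA.
rewrite (eq_bigr _ step) !big_split /= [in RHS](bigD1 (Ordinal ae1)) //=.
rewrite drop_take_id [run S vacuum [::]]/= VE (ltn_eqF ae) ae add0r J1D.
rewrite -(morph_sum J1D) -(morph_sum τD) -(morph_sum outD) -/(Q a).
rewrite [in RHS](eq_bigl (fun k : 'I_e.+1 => (a < k)%N)) => [|k]; last first.
  by rewrite andbC [RHS]ltn_neqAle eq_sym.
by rewrite addrA [LHS]addrAC [X in _ = X + _]addrC addrA.
Qed.

(* Without a source, everything in T(H) ⊗ N stems from the initial vector. *)
Hypothesis σ0 : forall y, σ y = 0.

(** The whole word is expanded: what has not left T(H) ⊗ N, plus what left it at
some position l and was then acted on by the letters on the left of l. *)
Lemma run_excursions a : (a <= e)%N ->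
  run Y (J vacuum g0) (word a e) = excursions a +
    \sum_(l < e.+1 | (a <= l)%N) run Y (out (Q l)) (word a l).
Proof.
move=> ae; have [d ad] : exists d, (a + d)%N = e by exists (e - a)%N; rewrite subnKC.
elim: d a ad {ae} => [|d IHd] a ad.
  rewrite addn0 in ad; rewrite ad excursions_end drop_take_id [run _ _ _]/=.
  rewrite (big_pred1 ord_max) => [|k]; last first.
    by rewrite /= -[RHS]/((k : nat) == e) eqn_leq leq_ord.
  by rewrite /= drop_take_id /= chain_tail_end (morph_add0 outD) addr0.
have ae : (a < e)%N by rewrite -ad addnS ltnS leq_addr.
have ae1 : (a < e.+1)%N by exact: ltnW.
have lD : {morph (@lact _ _ _ M b`_a) : x y / x + y} by move=> x y; rewrite lactDr.
rewrite (drop_take_cons 0 ae eb).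
rewrite -[LHS]/(Y (b`_a ▷ run Y (J vacuum g0) (word a.+1 e))) IHd ?addSnnS //.
have step := excursions_step ae; rewrite σ0 (morph_add0 J1D) addr0 in step.
rewrite lactDr YD step -addrA; congr (_ + _).
rewrite [RHS](bigD1 (Ordinal ae1)) //= drop_take_id; congr (_ + _).
rewrite (morph_sum lD) (morph_sum YD); apply: eq_big => [k|k ak].
  by rewrite andbC [LHS]ltn_neqAle eq_sym.
by rewrite (drop_take_cons 0 ak (leq_trans (leq_ord k) eb)).
Qed.

End Transfer.

(** * The cumulants as ladders *)

(** The vector τ y_1 τ y_2 ... τ y_(n-1) (x y_n); the value 0 at the empty word
stands for the absence of a vector in N before x is created. *)
Fixpoint ladder (R : realType) (B A : cstarAlgType R) (i : B -> A)
    (N : corr B A) (x : N) (τ : N -> N) (r : seq B) : N :=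
  match r with
  | [::] => 0
  | [:: y] => x ◁ i y
  | y :: r' => τ (y ▷ ladder i x τ r')
  end.

(** The right-hand sides of the theorem: free cumulants for i = id and
(x, τ) = (ξ, t), c-free cumulants for (x, τ) = (η, T). *)
Definition ladder_cumulant (R : realType) (B A : cstarAlgType R) (i : B -> A)
    (N : corr B A) (x : N) (τ : N -> N) (lambda : A) (r : seq B) : A :=
  match r with
  | [::] => 0
  | [:: y] => lambda * i y
  | y :: r' => ⟨y ▷ ladder i x τ r', x⟩
  end.

Section Ladder.
Context {R : realType} {B A : cstarAlgType R}.
Variables (i : B -> A) (N : corr B A) (x : N) (τ : N -> N) (lambda : A).

Lemma ladder_rcons r y :
  ladder i x τ (rcons r y) = foldr (fun c z => τ (c ▷ z)) (x ◁ i y) r.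
Proof. by elim: r => //= c r <-; case: r. Qed.

Lemma ladder_cumulant_rcons r y : ladder_cumulant i x τ lambda (rcons r y) =
  if r is c :: r' then ⟨c ▷ ladder i x τ (rcons r' y), x⟩ else lambda * i y.
Proof. by case: r => //= c r; case: r. Qed.

Hypothesis τ0 : τ 0 = 0.

Lemma ladder_cons y r : ladder i x τ (y :: r) =
  τ (y ▷ ladder i x τ r) + if r is [::] then x ◁ i y else 0.
Proof. by case: r => [|c r] /=; rewrite ?lact0 ?τ0 ?add0r ?addr0. Qed.

Lemma ladder_cumulant_cons y r : ladder_cumulant i x τ lambda (y :: r) =
  ⟨y ▷ ladder i x τ r, x⟩ + if r is [::] then lambda * i y else 0.
Proof.
by case: r => [|c r] /=; rewrite ?lact0 ?Defs.form0l ?add0r ?addr0.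
Qed.

End Ladder.

(** * The free cumulants on the Fock module *)

Section FockCumulants.
Context {R : realType} {B : cstarAlgType R} (H : corr B B).
Variables (ξ : H) (t : rlin H H) (lambda : B).
Local Notation vacuum := (fock_scalar H 1).
Local Notation S := (fock_X ξ t lambda).
Local Notation fmoment := (vmoment S).

(** Write the vector produced by the letters from position a on as a scalar plus
a vector of T(H) ⊗ H.  The scalar m becomes λ m, and feeds T(H) ⊗ H through
a_ξ^* as the source; so T(H) ⊗ H is described by excursions.  The scalar
produced by the leftmost letter is thus λ m plus what a_ξ brings back, and this
is the recursion with its first block peeled. *)
Lemma fock_free_cumulants :
  free_cumulants fmoment (ladder_cumulant id ξ t lambda).
Proof.
move=> b b0; rewrite free_terms_chain_sum //.
set e := size b; have e0 : (0 < e)%N by rewrite lt0n size_eq0.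
have tD : {morph t : x y / x + y} by exact: rlinD.
have xiD : {morph (fun x => ⟨x, ξ⟩) : x y / x + y} by move=> x y; rewrite Defs.formDl.
pose V := chain_val (block fmoment b) e (ladder id ξ t).
pose Q := chain_tail (block fmoment b) e V.
have VE a : V a = (if a == e then 0 else 0) + t (Q a)
    + (if (a < e)%N then ξ ◁ block fmoment b a e else 0).
  by rewrite {1}/V (chain_val_peel _ _ tD (ladder_cons id ξ (rlin0 t))).
pose out (g : H) := fock_scalar H ⟨g, ξ⟩.
have outD : {morph out : x y / x + y}.
  by move=> x y; rewrite /out Defs.formDl (fock_scalarD H).
have step := excursions_step (fock_XD ξ t lambda) tD outD
  (@append_lact _ _ H) (@append_vacD _ _ H) (fock_X_append ξ t lambda) (leqnn e) VE.
pose u := excursions S (@append _ _ H) b e V.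
rewrite -/u in step.
(* append has no component in B, so that scalars can be read off there. *)
have level0 a : dval (u a) 0%N = 0.
  by rewrite (@morph_sum _ _ (fun x : fock H => dval x 0%N)) // big1.
have scalar_lact c α : c ▷ fock_scalar H α = fock_scalar H (c * α).
  by apply: dsumP => -[|n] //=; rewrite lact0.
have unfold a : (a < e)%N ->
    run S vacuum (drop a.+1 b) = u a.+1 + fock_scalar H (fmoment (drop a.+1 b)) ->
    run S vacuum (drop a b) =
      u a + fock_scalar H (⟨Q a, ξ⟩ + lambda * block fmoment b a e).
  move=> ae IH; rewrite (drop_nth 0 ae).
  rewrite -[LHS]/(S (b`_a ▷ run S vacuum (drop a.+1 b))) IH.
  rewrite lactDr fock_XD scalar_lact.
  have -> : b`_a * fmoment (drop a.+1 b) = block fmoment b a e.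
    by rewrite /block take_size.
  by rewrite fock_X_scalar addrA step // -addrA -fock_scalarD.
have run_drop a : (a <= e)%N ->
    run S vacuum (drop a b) = u a + fock_scalar H (fmoment (drop a b)).
  move=> ae; have [d ad] : exists d, (a + d)%N = e by exists (e - a)%N; rewrite subnKC.
  elim: d a ad {ae} => [|d IHd] a ad.
    rewrite addn0 in ad; rewrite ad drop_size /u (excursions_end _ tD VE).
    by rewrite (morph_add0 (@append_vacD _ _ H)) add0r.
  have ae : (a < e)%N by rewrite -ad addnS ltnS leq_addr.
  rewrite /vmoment (unfold a ae) ?IHd ?addSnnS //.
  by rewrite [dval (_ + _) 0%N]/= level0 add0r.
rewrite -[in LHS](drop0 b) /vmoment (unfold 0%N e0 (run_drop _ e0)).
rewrite [dval (_ + _) 0%N]/= level0 add0r.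
have lc := ladder_cumulant_cons id ξ t lambda.
rewrite -[RHS]/(chain_val (block fmoment b) e (ladder_cumulant id ξ t lambda) 0).
by rewrite (chain_val_peel _ _ xiD lc) e0 eq_sym (gtn_eqF e0) add0r.
Qed.

End FockCumulants.

(** * The c-free cumulants on the model *)

Section ModelCumulants.
Context {R : realType} {B D : cstarAlgType R} (i : unital_inclusion B D).
Context (H : corr B B) (K : corr D D).
Variables (ξ : H) (η : K) (t : adjointable H) (T : adjointable K).
Variables (lambda1 : B) (lambda2 : D).
Local Notation E := (modE i H K).
Local Notation X := (op_X (i := i) ξ η t T lambda1 lambda2).
Local Notation S := (fock_X ξ t lambda1).
Local Notation vacuum := (fock_scalar H 1).

Lemma monomial_run (Y : E -> E) b v : monomial Y b v = run Y v b.
Proof.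
elim: b => [//|c b IHb].
by rewrite -[LHS]/(Y (c ▷ monomial Y b v)) IHb.
Qed.

Definition inFockD (x : fock H) : E :=
  (x ⊗ (1 : restrict i (self_corr D)), 0, 0).

Definition inFockK (x : fock H) (ζ : restrict i K) : E := (0, 0, x ⊗ ζ).

Lemma inFockDD : {morph inFockD : x y / x + y}.
Proof. by move=> x y; rewrite /inFockD tpureDl; congr (_, _, _); rewrite addr0. Qed.

Lemma inFockD_lact (b : B) x : b ▷ inFockD x = inFockD (b ▷ x).
Proof. by congr (_, _, _); rewrite /= ?tliftE ?mulr0 ?tlift0. Qed.

Lemma on_fock_inFockD g x : on_fock g (inFockD x) = inFockD (g x).
Proof. by congr (_, _, _); rewrite ?tmapE ?rlin0. Qed.

Lemma phi_inFockD x : ⟨inFockD x, inD i H K 1⟩ = i (dval x 0%N).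
Proof.
by rewrite /= tformE form_vac mulr0 tform0l !addr0 /= star1 mul1r mulr1.
Qed.

Lemma inFockKDl ζ : {morph inFockK^~ ζ : x y / x + y}.
Proof. by move=> x y; rewrite /inFockK tpureDl; congr (_, _, _); rewrite addr0. Qed.

Lemma inFockKDr x : {morph inFockK x : ζ ζ' / ζ + ζ'}.
Proof. by move=> ζ ζ'; rewrite /inFockK tpureDr; congr (_, _, _); rewrite addr0. Qed.

Lemma inFockK_lact (b : B) x ζ : b ▷ inFockK x ζ = inFockK (b ▷ x) ζ.
Proof. by congr (_, _, _); rewrite /= ?tliftE ?mulr0 ?tlift0. Qed.

Lemma inK_lact (b : B) (ζ : K) : b ▷ inK i H ζ = inK i H (i b ▷ ζ).
Proof.
rewrite -[LHS]/(b ▷ inFockK vacuum ζ) inFockK_lact /inFockK /inK /vac.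
congr (_, _, _); rewrite -(tpureM (N := restrict i K)); congr tpure.
by apply: dsumP => -[|n] /=; rewrite ?mulr1 ?mul1r ?lact0 ?ract0.
Qed.

Lemma inOmega_lact (b : B) (d : D) : b ▷ inOmega i H K d = inOmega i H K (i b * d).
Proof. by congr (_, _, _); rewrite /= tlift0. Qed.

Lemma on_fock_inFockK g x ζ : on_fock g (inFockK x ζ) = inFockK (g x) ζ.
Proof. by congr (_, _, _); rewrite ?tmapE ?rlin0. Qed.

Lemma on_fock_inOmega g (d : D) : on_fock g (inOmega i H K d) = 0.
Proof. by congr (_, _, _); rewrite rlin0. Qed.

Lemma vacK_part_inFockK x ζ : vacK_part (inFockK x ζ) = dval x 0%N ▷ ζ.
Proof. exact: tliftE. Qed.

Lemma inK0 : inK i H (0 : K) = 0.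
Proof. by rewrite /inK /vac (tpure0r (N := restrict i K)). Qed.

Lemma op_X_inFockD x : X (inFockD x) = inFockD (S x).
Proof.
have v0 : vacK_part (inFockD x) = 0 by exact: tlift0.
have o0 : omega_part (inFockD x) = 0 by [].
rewrite /op_X /op_A /op_P /op_Astar v0 Defs.form0l rlin0 o0 ract0r inK0.
rewrite /omega_lact /op_I2 o0 [omega_part _]/= mulr0 !addr0.
by rewrite /op_a /op_astar /op_p !on_fock_inFockD (inFockD_lact lambda1) -!inFockDD.
Qed.

(** As A_η, P(T) vanish off 1 ⊗ K, they see x ⊗ ζ through x_0 ζ only. *)
Lemma op_X_inFockK x ζ : X (inFockK x ζ) =
  inFockK (S x) ζ + inFockK vacuum (T (dval x 0%N ▷ ζ))
  + inOmega i H K ⟨dval x 0%N ▷ ζ, η⟩.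
Proof.
have o0 : omega_part (inFockK x ζ) = 0 by [].
rewrite /op_X /op_A /op_P /op_Astar vacK_part_inFockK o0 ract0r inK0.
rewrite /omega_lact /op_I2 o0 [omega_part _]/= mulr0 !addr0.
rewrite /op_a /op_astar /op_p !on_fock_inFockK (inFockK_lact lambda1) -!inFockKDl.
by rewrite [RHS]addrAC.
Qed.

Lemma op_X_inOmega d : X (inOmega i H K d) =
  inK i H (η ◁ d) + inOmega i H K (lambda2 * d).
Proof.
have v0 : vacK_part (inOmega i H K d) = 0 by exact: tlift0.
rewrite /op_X /op_A /op_P v0 Defs.form0l rlin0 inK0.
rewrite /op_a /op_astar /op_p !on_fock_inOmega !add0r.
have -> : op_I1 (inOmega i H K d) = 0 by [].
by rewrite lact0 add0r addr0 add0r.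
Qed.

Lemma run_inFockD (Y : E -> E) (U : fock H -> fock H) x b :
  (forall y, Y (inFockD y) = inFockD (U y)) ->
  run Y (inFockD x) b = inFockD (run U x b).
Proof.
move=> YU; elim: b => [//|c b IHb].
by rewrite -[LHS]/(Y (c ▷ run Y (inFockD x) b)) IHb inFockD_lact YU.
Qed.

(** Words in X leave T(H) ⊗ 1 invariant, and act there on T(H). *)
Lemma phi_moment_vmoment b : phi_moment X b = vmoment S b.
Proof.
apply: (incl_inj (u := i)); rewrite phi_momentE /phi monomial_run.
by rewrite (run_inFockD vacuum b op_X_inFockD) phi_inFockD.
Qed.

Lemma omega_partD : {morph @omega_part _ _ _ i H K : x y / x + y}.
Proof. by []. Qed.

Lemma theta_omega_part (Y : E -> E) : theta Y = omega_part (Y (inOmega i H K 1)).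
Proof. by rewrite /theta form_inOmega star1 mul1r. Qed.

(** X is right D-linear, hence θ is the coefficient of X b_1 ... X b_n on all of
Ω D. *)
Lemma omega_run d b :
  omega_part (run X (inOmega i H K d) b) = theta_moment X b * d.
Proof.
rewrite /theta_moment theta_omega_part monomial_run.
have -> : run X (inOmega i H K d) b = run X (inOmega i H K 1) b ◁ d; last by [].
elim: b => [|c b IHb]; first by rewrite -[LHS]/(inOmega i H K d) -{1}[d]mul1r inOmega_ract.
by rewrite -[LHS]/(X (c ▷ run X (inOmega i H K d) b)) IHb lract op_X_ract.
Qed.

(** The rightmost letter sends 1 ⊗ Ω to Ω λ_2 c plus the vector 1 ⊗ η c of
T(H) ⊗ K.  The latter returns to Ω D at some position l, through A_η, and the
letters on the left of l contribute θ of that prefix; the former is the case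
l = e, where the ladder consists of c alone. *)
Lemma model_cfree_cumulants :
  cfree_cumulants (vmoment S) (theta_moment X)
    (ladder_cumulant (N := restrict i K) i η T lambda2).
Proof.
case/lastP => [//|b c] _.
rewrite (cfree_terms_chain_sum _ _ _ (size_rcons b c)) last_rcons.
set e := size b; set bc := rcons b c.
have ebc : (e <= size bc)%N by rewrite size_rcons.
pose N : corr B D := restrict i K.
have TD : {morph (T : N -> N) : x y / x + y} := rlinD T.
have etaD : {morph (fun x : N => ⟨x, η⟩) : x y / x + y}.
  by move=> x y; rewrite Defs.formDl.
pose out (g : N) : E := inOmega i H K ⟨g, η⟩.
have outD : {morph out : x y / x + y}.
  by move=> x y; rewrite /out Defs.formDl inOmegaD.
(* The last letter c is fixed, and only the letters before it are cut into
   blocks; it enters through the initial vector η c. *)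
pose G (r : seq B) : N := ladder (N := N) i η T (rcons r c).
pose V := chain_val (block (vmoment S) bc) e G.
pose Q := chain_tail (block (vmoment S) bc) e V.
(* Returns from Ω D to T(H) ⊗ K are counted in θ of a prefix, so that there is
   no source here, and only ladders ending with c occur. *)
have Gcons z zs : G (z :: zs) = T (z ▷ G zs) + if zs is [::] then 0 else 0.
  by rewrite /G !ladder_rcons /=; case: zs => [|? ?]; rewrite addr0.
have VE a : V a = (if a == e then η ◁ i c else 0) + T (Q a)
    + (if (a < e)%N then (fun=> 0) (block (vmoment S) bc a e) else 0).
  by rewrite {1}/V (chain_val_peel _ _ TD Gcons).
have run_inK := run_excursions (@op_X_add _ _ _ i H K ξ η t T lambda1 lambda2)
  TD outD inFockK_lact (inFockKDr vacuum) op_X_inFockK ebc VE (fun=> erefl)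
  (leq0n e).
have b_word : drop 0 (take e bc) = b by rewrite drop0 /bc -cats1 take_size_cat.
rewrite b_word in run_inK.
have omega_excursions u : omega_part (\sum_(k < e.+1 | (u <= k)%N)
    inFockK (run S vacuum (drop u (take k bc))) (V k)) = 0.
  by rewrite (morph_sum omega_partD) big1.
have -> : theta_moment X bc =
    omega_part (run X (inK i H (η ◁ i c)) b) + theta_moment X b * (lambda2 * i c).
  rewrite {1}/theta_moment theta_omega_part monomial_run run_rcons inOmega_lact mulr1.
  rewrite op_X_inOmega runD ?omega_partD ?omega_run //.
  exact: op_X_add.
rewrite -[inK _ _ _]/(inFockK vacuum (η ◁ i c)) run_inK omega_partD.
rewrite /excursions omega_excursions add0r (morph_sum omega_partD).
have chainE (l : 'I_e.+1) : chain_sum e (fun j =>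
      ladder_cumulant (N := N) i η T lambda2
        (rcons (pairmap (block (vmoment S) bc) l j) c)) l =
    (if l == ord_max then lambda2 * i c else 0) + ⟨Q l, η⟩.
  pose F r := ladder_cumulant (N := N) i η T lambda2 (rcons r c).
  have Fcons z zs : F (z :: zs) = ⟨z ▷ G zs, η⟩ + if zs is [::] then 0 else 0.
    by rewrite /F ladder_cumulant_rcons; case: zs => [|? ?]; rewrite addr0.
  rewrite -[LHS]/(chain_val (block (vmoment S) bc) e F l).
  rewrite (chain_val_peel _ _ etaD Fcons) (if_same _ 0) addr0.
  by rewrite -[(l : nat) == e]/(l == ord_max).
under [RHS]eq_bigr => l _ do rewrite chainE mulrDr.
rewrite big_split [LHS]addrC; congr (_ + _).
  rewrite [RHS](bigD1 ord_max) //= eqxx big1 ?addr0; last first.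
    by move=> l /= /negbTE ->; rewrite mulr0.
  by rewrite /bc -cats1 take_size_cat.
by apply: eq_bigr => l _; rewrite drop0 omega_run.
Qed.

Lemma fock_create_scalar α :
  fock_create ξ (fock_scalar H α) = append vacuum (ξ ◁ α).
Proof.
apply: dsumP => -[|[|n]] //; first by rewrite -[RHS]/(1 ▷ (ξ ◁ α)) lact1.
by rewrite -[LHS]/(hcreate ξ n.+1 0) -[RHS]/(rcreate _ n.+1 0) rlin0 llin0.
Qed.

Lemma fock_first_append1 (g : H) :
  fock_first t (append vacuum g) = append vacuum (t g).
Proof.
apply: dsumP => -[|[|n]] //; first by rewrite -[LHS]/(t (1 ▷ g)) !lact1 -[RHS]/(1 ▷ t g) lact1.
rewrite -[LHS]/(hfirst t n.+2 (rcreate g n.+1 0)) -[RHS]/(rcreate (t g) n.+1 0).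
by rewrite !llin0 rlin0.
Qed.

Lemma append1_lact c (g : H) : c ▷ append vacuum g = append vacuum (c ▷ g).
Proof.
apply: dsumP => -[|[|n]]; first by rewrite /= mulr0.
  by rewrite -[LHS]/(c ▷ (1 ▷ g)) -[RHS]/(1 ▷ (c ▷ g)) !lact1.
rewrite -[LHS]/(c ▷ rcreate g n.+1 0) -[RHS]/(rcreate (c ▷ g) n.+1 0).
by rewrite !llin0 lact0.
Qed.

(** On the left of a_ξ^* every p(t) preserves the summand H of T(H) and acts on it
as t; then a_ξ returns from H to B. *)
Lemma phi_ladder c b d : phi (i := i) (K := K)
    (op_a ξ \o lact c \o monomial (op_p t) b \o op_astar ξ \o lact d) =
  i ⟨c ▷ ladder id ξ t (rcons b d), ξ⟩.
Proof.
rewrite ladder_rcons.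
have pE y : op_p t (inFockD y) = inFockD (fock_first t y) by exact: on_fock_inFockD.
have runE g : run (fock_first t) (append vacuum g) b =
    append vacuum (foldr (fun c z => t (c ▷ z)) g b).
  elim: b => [//|c' b IHb].
  rewrite -[LHS]/(fock_first t (c' ▷ run (fock_first t) (append vacuum g) b)) IHb.
  by rewrite append1_lact fock_first_append1.
rewrite /phi -[X in ⟨X, _⟩]/(op_a ξ (c ▷ monomial (op_p t) b
  (op_astar ξ (d ▷ inFockD vacuum)))).
rewrite inFockD_lact /op_astar on_fock_inFockD monomial_run (run_inFockD _ _ pE).
have -> : d ▷ vacuum = fock_scalar H d.
  by apply: dsumP => -[|n] /=; rewrite ?mulr1 ?lact0.
rewrite fock_create_scalar runE inFockD_lact append1_lact /op_a on_fock_inFockD.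
by rewrite phi_inFockD /= lact1.
Qed.

Lemma theta_ladder c b d : theta (i := i) (H := H)
    (op_A η \o lact c \o monomial (op_P T) b \o op_Astar η \o lact d) =
  ⟨c ▷ ladder (N := restrict i K) i η T (rcons b d), η⟩.
Proof.
rewrite ladder_rcons theta_omega_part.
have PE ζ : op_P T (inK i H ζ) = inK i H (T ζ) by rewrite /op_P vacK_part_inK.
have runE ζ : run (op_P T) (inK i H ζ) b =
    inK i H (foldr (fun c z => T (c ▷ z : restrict i K)) ζ b).
  elim: b => [//|c' b IHb].
  rewrite -[LHS]/(op_P T (c' ▷ run (op_P T) (inK i H ζ) b)) IHb.
  by rewrite inK_lact PE.
rewrite -[X in omega_part X]/(op_A η (c ▷ monomial (op_P T) b
  (op_Astar η (d ▷ inOmega i H K 1)))).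
rewrite inOmega_lact mulr1 monomial_run /op_Astar runE inK_lact.
by rewrite /op_A vacK_part_inK.
Qed.

End ModelCumulants.

Theorem lemma4p7 (R : realType) (B D : cstarAlgType R)
    (i : unital_inclusion B D) (H : sipBimod B) (K : sipBimod D)
    (xi : H) (eta : K) (t : adjointable H) (T : adjointable K)
    (lambda1 : B) (lambda2 : D)
    (t_selfadjoint : selfadjoint t) (T_selfadjoint : selfadjoint T)
    (lambda1_selfadjoint : star lambda1 = lambda1)
    (lambda2_selfadjoint : star lambda2 = lambda2) :
  let X : modE i H K -> modE i H K := op_X xi eta t T lambda1 lambda2 in
  forall (kappa : seq B -> B) (ckappa : seq B -> D),
    free_cumulants (phi_moment X) kappa ->
    cfree_cumulants (phi_moment X) (theta_moment X) ckappa ->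
    [/\ forall b1 : B, kappa [:: b1] = lambda1 * b1,
        forall (b1 : B) (b : seq B) (bn : B),
          i (kappa (b1 :: rcons b bn)) =
          phi (i := i) (K := K) (op_a xi \o lact b1 \o monomial (op_p t) b
                        \o op_astar xi \o lact bn),
        forall b1 : B, ckappa [:: b1] = lambda2 * i b1
      & forall (b1 : B) (b : seq B) (bn : B),
          ckappa (b1 :: rcons b bn) =
          theta (i := i) (H := H) (op_A eta \o lact b1 \o monomial (op_P T) b
                                   \o op_Astar eta \o lact bn)].
Proof.
move=> X kappa ckappa.
have -> : phi_moment X = vmoment (fock_X xi t lambda1).
  by apply: boolp.funext => b; exact: phi_moment_vmoment.
have theta1 : theta_moment X [::] = 1.
  by rewrite /theta_moment theta_omega_part.
move=> kappaP ckappaP.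
have [_ kappa_uniq] := free_cumulants_exist_unique
  (erefl : vmoment (fock_X xi t lambda1) [::] = 1).
have [_ ckappa_uniq] := cfree_cumulants_exist_unique
  (erefl : vmoment (fock_X xi t lambda1) [::] = 1) theta1.
have {kappa_uniq} kappaE :=
  kappa_uniq _ _ kappaP (fock_free_cumulants xi t lambda1).
have {ckappa_uniq} ckappaE :=
  ckappa_uniq _ _ ckappaP (model_cfree_cumulants i xi eta t T lambda1 lambda2).
split=> [b1|b1 b bn|b1|b1 b bn]; rewrite ?kappaE ?ckappaE //.
- by rewrite -rcons_cons ladder_cumulant_rcons phi_ladder.
- by rewrite -rcons_cons ladder_cumulant_rcons theta_ladder.
Qed.
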